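(* Let $\Phi:\mathcal{L}(\mathcal{H}_2)\to\mathcal{L}(\mathcal{H}_2)$ be a nonzero positive map. Then: (a) If $\Phi\in\mathcal{SP}_1$, then $\mathcal{M}_{\{\Phi\}}=\mathcal{SP}_1$. (b) If $\Phi\in\mathcal{CP}\setminus\mathcal{SP}_1$ and ${\rm rank}(C_\Phi)=1$, then $\mathcal{M}_{\{\Phi\}}=\mathcal{CP}$. (c) If $\Phi\in\mathcal{CP}\setminus\mathcal{SP}_1$ and ${\rm rank}(C_\Phi)\ge 2$, then $\mathcal{M}_{\{\Phi\}}$ is untypical. (d) If $\Phi\in(\mathcal{CP}\circ t)\setminus\mathcal{SP}_1$ and ${\rm rank}(C_{\Phi\circ t})=1$, then $\mathcal{M}_{\{\Phi\}}=\mathcal{CP}\circ t$. (e) If $\Phi\in(\mathcal{CP}\circ t)\setminus\mathcal{SP}_1$ and ${\rm rank}(C_{\Phi\circ t})\ge 2$, then $\mathcal{M}_{\{\Phi\}}$ is untypical. (f) If $\Phi\notin\mathcal{CP}\cup(\mathcal{CP}\circ t)$, then $\mathcal{M}_{\{\Phi\}}$ is untypical.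
   Context: $\mathcal{H}_2$ is a $2$-dimensional complex Hilbert space with a fixed orthonormal basis $e_1,e_2$, $\mathcal{L}(\mathcal{H}_2)$ is the space of linear operators on it, and $t$ is the transpose map on $\mathcal{L}(\mathcal{H}_2)$ with respect to this basis. The Choi matrix of a linear map $\Phi$ on $\mathcal{L}(\mathcal{H}_2)$ is $C_\Phi:=\sum_{i,j=1}^2 e_ie_j^*\otimes\Phi(e_ie_j^* )$. A linear map $\Phi$ is positive if $\Phi(X)\ge 0$ whenever $X\ge 0$ (positive semidefinite), $k$-positive if $id_k\otimes\Phi$ is positive ($id_k$ the identity map on the $k\times k$ matrices), and completely positive if it is $k$-positive for all $k$. $\mathcal{P}_k$ and $\mathcal{CP}=\mathcal{P}_2$ denote the cones of $k$-positive and completely positive maps on $\mathcal{L}(\mathcal{H}_2)$. With ${\rm Ad}_A(X)=AXA^*$, $\mathcal{SP}_k$ is the cone of $k$-superpositive maps: finite sums $\sum_i{\rm Ad}_{A_i}$ with ${\rm rank}(A_i)\le k$ for all $i$. For a cone $\mathcal{M}$ of maps, $\mathcal{M}\circ t:=\{\Phi\circ t:\Phi\in\mathcal{M}\}$. For a set $\mathcal{Q}$ of positive maps, the convex mapping cone generated by $\mathcal{Q}$ is $\mathcal{M}_{\mathcal{Q}}:=\{\sum_i\Phi_i\circ\Omega_i\circ\Psi_i:\Omega_i\in\mathcal{Q},\ \Phi_i,\Psi_i\in\mathcal{CP}\ \forall i\}$ (finite sums). A cone of positive maps on $\mathcal{L}(\mathcal{H}_2)$ is called typical if it can be obtained from the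 cones $\mathcal{P}_k$ and $\mathcal{SP}_k$ ($1\le k\le 2$) by finitely many applications of the operations $\mathcal{M}\mapsto\mathcal{M}\circ t$, $(\mathcal{M}_1,\mathcal{M}_2)\mapsto\mathcal{M}_1\cap\mathcal{M}_2$, and $(\mathcal{M}_1,\mathcal{M}_2)\mapsto\mathcal{M}_1\vee\mathcal{M}_2:=\{\Phi+\Psi:\Phi\in\mathcal{M}_1,\Psi\in\mathcal{M}_2\}$; it is untypical if it is not typical. *)

(* Defs.v *)
From mathcomp Require Import all_boot all_order all_algebra.
From mathcomp Require Import spectral complex mxtens.
From mathcomp Require Import boolp classical_sets reals.

Set Implicit Arguments.
Unset Strict Implicit.
Unset Printing Implicit Defensive.

Import Order.TTheory GRing.Theory Num.Theory.
Local Open Scope ring_scope.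
Local Open Scope complex_scope.
Local Open Scope sesquilinear_scope.
Local Open Scope classical_set_scope.

(* The Hilbert space H_2 is C^2 with its standard basis, so that operators on
   it are the 2 x 2 matrices over R[i]. *)
Notation superop R := 'End('M[R[i]]_2).

Section SuperOperators.
Variable R : realType.
Local Notation C := R[i].

(* The order of R[i] is partial: 0 <= z states that z is real and nonnegative.
   Hence a matrix satisfying this condition is Hermitian. *)
Definition psd n (X : 'M[C]_n) : Prop :=
  forall v : 'cV[C]_n, 0 <= (v^t* *m X *m v) ord0 ord0.

Definition positive_map m n (f : 'M[C]_m -> 'M[C]_n) : Prop :=
  forall X, psd X -> psd (f X).

Definition mxtens_block k (X : 'M[C]_(k * 2)) (i j : 'I_k) : 'M[C]_2 :=
  \matrix_(a, b) X (mxtens_index (i, a)) (mxtens_index (j, b)).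

(* X = \sum_(i, j) E_ij *t X_ij is mapped to \sum_(i, j) E_ij *t Phi X_ij. *)
Definition id_tens k (Phi : superop R) (X : 'M[C]_(k * 2)) : 'M[C]_(k * 2) :=
  \sum_(i < k) \sum_(j < k) delta_mx i j *t Phi (mxtens_block X i j).

Lemma id_tensE k (Phi : superop R) (A : 'M[C]_k) (B : 'M[C]_2) :
  id_tens Phi (A *t B) = A *t Phi B.
Proof.
have blockE i j : mxtens_block (A *t B) i j = A i j *: B.
  by apply/matrixP => a b; rewrite mxE tensmxE mxE.
apply/matrixP => p q; case: (mxtens_indexP p) => p1 p2.
case: (mxtens_indexP q) => q1 q2; rewrite tensmxE /id_tens summxE.
rewrite (bigD1 p1) //= [X in _ + X]big1 ?addr0 => [|i /negPf ip]; last first.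
  rewrite summxE big1 // => j _.
  by rewrite tensmxE mxE [p1 == i]eq_sym ip mul0r.
rewrite summxE (bigD1 q1) //= [X in _ + X]big1 ?addr0 => [|j /negPf jq].
  by rewrite tensmxE !mxE !eqxx mul1r blockE linearZ mxE.
by rewrite tensmxE mxE [q1 == j]eq_sym jq andbF mul0r.
Qed.

Definition k_positive k (Phi : superop R) : Prop :=
  positive_map (@id_tens k Phi).

Definition k_positive_cone k : set (superop R) := [set Phi | k_positive k Phi].

Definition cp_cone : set (superop R) := [set Phi | forall k, k_positive k Phi].

Definition Ad (A : 'M[C]_2) : superop R :=
  linfun (mulmxr (A^t*) \o mulmx A).

Lemma AdE A X : Ad A X = A *m X *m A^t*.
Proof. by rewrite lfunE. Qed.

Definition superpositive_cone k : set (superop R) :=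
  [set Phi | exists n (A : 'I_n -> 'M[C]_2),
     (forall i, (\rank (A i) <= k)%N) /\ Phi = \sum_(i < n) Ad (A i)].

Definition transp : superop R := linfun trmx.

Lemma transpE X : transp X = X^T.
Proof. by rewrite lfunE. Qed.

Definition cone_transp (M : set (superop R)) : set (superop R) :=
  [set (Phi \o transp)%VF | Phi in M].

Definition cone_join (M1 M2 : set (superop R)) : set (superop R) :=
  [set Phi + Psi | Phi in M1 & Psi in M2].

Definition choi (Phi : superop R) : 'M[C]_(2 * 2) :=
  \sum_(i < 2) \sum_(j < 2) delta_mx i j *t Phi (delta_mx i j).

Definition mapping_cone (Q : set (superop R)) : set (superop R) :=
  [set Theta | exists n (Phi Omega Psi : 'I_n -> superop R),
     (forall i, [/\ Q (Omega i), cp_cone (Phi i) & cp_cone (Psi i)]) /\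
     Theta = \sum_(i < n) (Phi i \o Omega i \o Psi i)%VF].

Inductive typical : set (superop R) -> Prop :=
| typical_positive k : (1 <= k <= 2)%N -> typical (k_positive_cone k)
| typical_superpositive k : (1 <= k <= 2)%N -> typical (superpositive_cone k)
| typical_transp M : typical M -> typical (cone_transp M)
| typical_meet M1 M2 : typical M1 -> typical M2 -> typical (M1 `&` M2)
| typical_join M1 M2 : typical M1 -> typical M2 -> typical (cone_join M1 M2).

Definition untypical (M : set (superop R)) : Prop := ~ typical M.

End SuperOperators.

Arguments k_positive_cone R k : clear implicits.
Arguments cp_cone R : clear implicits.
Arguments superpositive_cone R k : clear implicits.
Arguments transp R : clear implicits.

(* Main.v *)
(* The identity map spans an extremal ray of the cone of positive maps. Hence, if
   the identity belongs to the mapping cone generated by [Phi], it is a multiple of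
   some [Ad_A o Phi o Ad_B] with [A] and [B] invertible, and [Phi] is itself of the
   form [Ad_M]. On the other hand, a typical cone either contains the identity or
   lies in [CP o t]. So the mapping cone of [Phi] is untypical as soon as [Phi] is
   neither in [CP o t] nor of the form [Ad_M].

   When [Phi] is completely positive, [Phi] in [CP o t] means [Phi] in [SP_1] (the
   Peres-Horodecki criterion). To see this, normalise [Phi E00 = 1] and put
   [B = Phi E01], [D = Phi E11]; then [D] dominates both [B^* B] and [B B^*]. One
   finds [D' <= D] such that [D' - B B^* = x x^*] and [D' - B^* B = y y^*], and then a
   scalar [z] making the 3 x 3 matrix with blocks [B], [x], [y^*], [z] normal. Its
   spectral decomposition, compressed to the first two coordinates, writes [1],
   [B] and [D'] as sums of [f f^*], [c f f^*] and [|c|^2 f f^*], which is a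
   decomposition of [Phi] into maps of rank one. *)
Require Import Defs.
From mathcomp Require Import all_boot all_order all_algebra.
From mathcomp Require Import spectral complex mxtens.
From mathcomp Require Import boolp classical_sets reals.
From mathcomp Require Import ring.

Set Implicit Arguments.
Unset Strict Implicit.

Import Order.TTheory GRing.Theory Num.Theory.
Local Open Scope ring_scope.
Local Open Scope classical_set_scope.

(** * Adjoints and positive semidefinite matrices *)

Section Adjoint.
Local Open Scope sesquilinear_scope.
Context {C : numClosedFieldType}.

Lemma adjmxM m n p (A : 'M[C]_(m, n)) (B : 'M[C]_(n, p)) :
  (A *m B)^t* = B^t* *m A^t*.
Proof. by rewrite trmx_mul map_mxM. Qed.

Lemma adjmxD m n (A B : 'M[C]_(m, n)) : (A + B)^t* = A^t* + B^t*.
Proof. by rewrite linearD map_mxD. Qed.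

Lemma adjmxB m n (A B : 'M[C]_(m, n)) : (A - B)^t* = A^t* - B^t*.
Proof. by rewrite linearB map_mxB. Qed.

Lemma adjmxZ m n c (A : 'M[C]_(m, n)) : (c *: A)^t* = c^* *: A^t*.
Proof. by rewrite linearZ map_mxZ. Qed.

Lemma adjmx1 n : (1%:M : 'M[C]_n)^t* = 1%:M.
Proof. by rewrite trmx1 map_mx1. Qed.

Lemma adjmx_delta m n i j : (delta_mx i j : 'M[C]_(m, n))^t* = delta_mx j i.
Proof. by rewrite trmx_delta map_delta_mx. Qed.

Lemma adjmx_sum m n I (r : seq I) (P : pred I) (F : I -> 'M[C]_(m, n)) :
  (\sum_(i <- r | P i) F i)^t* = \sum_(i <- r | P i) (F i)^t*.
Proof. by rewrite linear_sum map_mx_sum. Qed.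

Lemma dotmx_ge0 n (v : 'cV[C]_n) : 0 <= (v^t* *m v) 0 0.
Proof.
by rewrite mxE sumr_ge0 // => i _; rewrite !mxE mulrC mul_conjC_ge0.
Qed.

Lemma dotmx_eq0 n (v : 'cV[C]_n) : ((v^t* *m v) 0 0 == 0) = (v == 0).
Proof.
apply/eqP/eqP => [|->]; last by rewrite mulmx0 mxE.
rewrite mxE => /eqP; rewrite psumr_eq0 => [/allP v0|i _]; last first.
  by rewrite !mxE mulrC mul_conjC_ge0.
apply/colP => i; have := v0 i (mem_index_enum _).
by rewrite !mxE mulrC mul_conjC_eq0 => /eqP.
Qed.

Lemma addmx11 (A B : 'M[C]_1) : (A + B) 0 0 = A 0 0 + B 0 0.
Proof. by rewrite mxE. Qed.

Lemma scalemx11 c (A : 'M[C]_1) : (c *: A) 0 0 = c * A 0 0.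
Proof. by rewrite mxE. Qed.

Lemma adjmx11 (A : 'M[C]_1) : (A^t*) 0 0 = (A 0 0)^*.
Proof. by rewrite !mxE. Qed.

(** Polarisation: the value at [e i + c *: e j] is [c * K i j + c^* * K j i] once the diagonal
    vanishes, and [c = 1] and [c = 'i] together separate the two entries. *)
Lemma form_eq0 n (K : 'M[C]_n) :
  (forall v : 'cV[C]_n, (v^t* *m K *m v) 0 0 = 0) -> K = 0.
Proof.
move=> K0; pose e i : 'cV[C]_n := delta_mx i 0.
have eKe i j : ((e i)^t* *m K *m e j) 0 0 = K i j.
  by rewrite adjmx_delta -rowE -colE !mxE.
have Kii i : K i i = 0 by rewrite -eKe K0.
have polar (c : C) i j : c * K i j + c^* * K j i = 0.
  have := K0 (e i + c *: e j).
  rewrite adjmxD adjmxZ !mulmxDl !mulmxDr -!scalemxAl -!scalemxAr.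
  rewrite !addmx11 !scalemx11 !eKe !Kii !mulr0 add0r addr0 => <-.
  by rewrite addrC.
apply/matrixP => i j; rewrite mxE.
have := polar 1 i j; have := polar 'i i j.
rewrite rmorph1 !mul1r conjCi mulNr => /eqP; rewrite subr_eq0.
move=> /eqP/(mulfI (neq0Ci _))<- /eqP.
by rewrite -mulr2n mulrn_eq0 => /eqP.
Qed.

(** The sum is the squared norm of a^* u + b^* v. It is what one Kraus operator with columns [a] and
    [b] contributes to the form of a Choi matrix. *)
Lemma outer_form_ge0 n (a b u v : 'cV[C]_n) :
  0 <= (u^t* *m (a *m a^t*) *m u + u^t* *m (a *m b^t*) *m v
      + v^t* *m (b *m a^t*) *m u + v^t* *m (b *m b^t*) *m v) 0 0.
Proof.
have := dotmx_ge0 (a^t* *m u + b^t* *m v).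
by rewrite adjmxD !adjmxM !trmxCK mulmxDl !mulmxDr !mulmxA addrA.
Qed.

(** Taking [- b *: v] as first argument turns the block form into its Schur complement. As the
    off-diagonal block is a multiple of [M], this also works for singular [M]. *)
Lemma schur_form n (M D : 'M[C]_n) (v : 'cV[C]_n) b : M^t* = M ->
  (- b *: v)^t* *m M *m (- b *: v) + (- b *: v)^t* *m (b *: M) *m v
    + v^t* *m (b *: M)^t* *m (- b *: v) + v^t* *m D *m v
  = v^t* *m (D - (b^* * b) *: M) *m v.
Proof.
move=> MH; rewrite !adjmxZ MH rmorphN /= mulmxBr mulmxBl.
rewrite -!(scalemxAl, scalemxAr) !scalerA -!scalerDl addrC -scaleNr.
by congr (_ + _ *: _); ring.
Qed.

Lemma normalmx_unitary_diag n (N : 'M[C]_n) : N \is normalmx ->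
  exists2 P : 'M[C]_n, P \is unitarymx & exists d, N = P^t* *m diag_mx d *m P.
Proof.
move=> NN; exists (spectralmx N); first exact: spectral_unitarymx.
exists (spectral_diag N).
by rewrite {1}(orthomx_spectralP NN) invmx_unitary ?spectral_unitarymx.
Qed.
End Adjoint.

Section Psd.
Local Open Scope sesquilinear_scope.
Context {R : realType}.
Local Notation C := R[i].

Lemma psd_gram m n (A : 'M[C]_(m, n)) : psd (A *m A^t*).
Proof.
move=> v; rewrite mulmxA -[_ *m A^t* *m v]mulmxA.
by rewrite -[A in v^t* *m A]trmxCK -adjmxM dotmx_ge0.
Qed.

Lemma psd_congr m n (A : 'M[C]_(m, n)) (M : 'M[C]_n) :
  psd M -> psd (A *m M *m A^t*).
Proof. by move=> Mp v; have := Mp (A^t* *m v); rewrite adjmxM trmxCK !mulmxA. Qed.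

Lemma psd0 n : psd (0 : 'M[C]_n).
Proof. by move=> v; rewrite mulmx0 mul0mx mxE. Qed.

Lemma psdD n (A B : 'M[C]_n) : psd A -> psd B -> psd (A + B).
Proof. by move=> Ap Bp v; rewrite mulmxDr mulmxDl mxE addr_ge0 ?Ap ?Bp. Qed.

Lemma psd_sum n I (r : seq I) (P : pred I) (F : I -> 'M[C]_n) :
  (forall i, psd (F i)) -> psd (\sum_(i <- r | P i) F i).
Proof. by move=> Fp; elim/big_rec: _ => [|i A _]; [exact: psd0|exact: psdD]. Qed.

Lemma psdZ n c (A : 'M[C]_n) : 0 <= c -> psd A -> psd (c *: A).
Proof.
by move=> c0 Ap v; rewrite -scalemxAr -scalemxAl mxE mulr_ge0 ?Ap.
Qed.

Lemma psd_diag n (A : 'M[C]_n) i : psd A -> 0 <= A i i.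
Proof.
by move=> /(_ (delta_mx i 0)); rewrite adjmx_delta -rowE -colE !mxE.
Qed.

(** A nonnegative form is real, so [A] and its adjoint have the same form, and [form_eq0] applies to
    their difference. *)
Lemma psd_adj n (A : 'M[C]_n) : psd A -> A^t* = A.
Proof.
move=> Ap; apply/eqP; rewrite -subr_eq0; apply/eqP/form_eq0 => v.
rewrite mulmxBr mulmxBl mxE [X in _ + X]mxE; apply/eqP; rewrite subr_eq0.
have /ger0_real/conj_Creal/= <- := Ap v.
by rewrite -adjmx11 !adjmxM trmxCK mulmxA.
Qed.

Lemma psd_gram_exists n (M : 'M[C]_n) : psd M ->
  exists W : 'M[C]_n, M = W *m W^t*.
Proof.
move=> Mp; have Mn : M \is normalmx by apply/normalmxP; rewrite psd_adj.
have [P PU [d ME]] := normalmx_unitary_diag Mn.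
have d_ge0 i : 0 <= d 0 i.
  have := psd_diag i (psd_congr P Mp).
  rewrite ME !mulmxA (unitarymxP PU) mul1mx -mulmxA (unitarymxP PU) mulmx1.
  by rewrite mxE eqxx.
exists (P^t* *m diag_mx (map_mx sqrtC d)).
rewrite adjmxM trmxCK !mulmxA -[_ *m diag_mx _ *m _]mulmxA {1}ME.
congr (_ *m _ *m _); apply/matrixP => i j; rewrite mul_diag_mx !mxE.
case: eqVneq => [->|]; last by rewrite !mulr0n conjC0 mulr0.
rewrite !mulr1n -[LHS]sqrtCK expr2; congr (_ * _).
by rewrite conj_Creal // ger0_real // sqrtC_ge0.
Qed.

Lemma psd_ker n (M : 'M[C]_n) (v : 'cV[C]_n) :
  psd M -> (v^t* *m M *m v) 0 0 = 0 -> M *m v = 0.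
Proof.
move=> /psd_gram_exists[W ->].
have -> : v^t* *m (W *m W^t*) *m v = (W^t* *m v)^t* *m (W^t* *m v).
  by rewrite adjmxM trmxCK !mulmxA.
by move=> /eqP; rewrite dotmx_eq0 -mulmxA => /eqP ->; rewrite mulmx0.
Qed.

(** The 2 x 2 minors vanish, so [M] is recovered from its column through a nonzero diagonal entry,
    divided by the square root of that entry. If the whole diagonal vanishes, [psd_ker] shows that
    [M] kills every basis vector. *)
Lemma psd_rank1 n (M : 'M[C]_n) :
  psd M -> (\rank M <= 1)%N -> exists w : 'cV[C]_n, M = w *m w^t*.
Proof.
move=> Mp rM; have [i Mii|M0] := pickP (fun i => M i i != 0); last first.
  exists 0; rewrite mul0mx; apply/matrixP => i j; rewrite mxE.
  have Mj : M *m delta_mx j 0 = 0 :> 'cV_n.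
    apply: (psd_ker Mp); rewrite adjmx_delta -rowE -colE !mxE.
    exact/eqP/negbFE/M0.
  by move/colP/(_ i): Mj; rewrite -colE !mxE.
have minor a b : M a b * M i i = M a i * M i b.
  have: M = col_base M *m row_base M by rewrite mulmx_base.
  move: (col_base M) (row_base M); case: (\rank M) rM => [|[|//]] _ c r ->.
    by rewrite (flatmx0 r) mulmx0 !mxE !mul0r.
  by rewrite !mxE !big_ord1 mulrACA [RHS]mulrACA [r 0 b * _]mulrC.
have Mii_ge0 := psd_diag i Mp.
have sqrt_real : (sqrtC (M i i))^-1^* = (sqrtC (M i i))^-1.
  by rewrite conj_Creal // realV ger0_real // sqrtC_ge0.
exists ((sqrtC (M i i))^-1 *: col i M); rewrite adjmxZ sqrt_real.
rewrite -scalemxAl -scalemxAr scalerA -expr2 exprVn sqrtCK.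
apply/matrixP => a b; rewrite !mxE big_ord1 !mxE.
have -> : M b i = (M i b)^*%R by rewrite -{1}(psd_adj Mp) !mxE.
by rewrite conjCK -minor mulrC mulfK.
Qed.

Lemma det_psd n (M : 'M[C]_n) : psd M -> 0 <= \det M.
Proof.
move=> /psd_gram_exists[W ->].
by rewrite det_mulmx det_map_mx det_tr mul_conjC_ge0.
Qed.
End Psd.

(** * Hermitian matrices of order two *)

Section Planar.
Local Open Scope sesquilinear_scope.

Lemma det_mx22 (F : comPzRingType) (M : 'M[F]_2) :
  \det M = M 0 0 * M 1 1 - M 0 1 * M 1 0.
Proof.
rewrite (expand_det_row _ 0) !big_ord_recl big_ord0 addr0 /cofactor.
rewrite !det_mx11 !mxE /= expr0 expr1 mul1r mulN1r mulrN.
by congr (M _ _ * M _ _ - M _ _ * M _ _); apply/val_inj.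
Qed.

(** Multiplying by [c] allows completing the square; if [c = 0], the determinant condition forces
    [b = 0]. *)
Lemma quadratic_form2_ge0 (C : numClosedFieldType) (a b c x y : C) :
  0 <= a -> 0 <= c -> 0 <= a * c - b * b^* ->
  0 <= x^* * a * x + x^* * b * y + y^* * b^* * x + y^* * c * y.
Proof.
move=> a0; rewrite le_eqVlt => /predU1P[<-|c0] d0.
  have -> : b = 0.
    apply/eqP; rewrite -mul_conjC_eq0 eq_le mul_conjC_ge0 andbT.
    by move: d0; rewrite mulr0 sub0r oppr_ge0.
  rewrite rmorph0 !mulr0 !mul0r !addr0 mulrAC mulr_ge0 //.
  by rewrite mulrC mul_conjC_ge0.
rewrite -(pmulr_rge0 _ c0).
have -> : c * (x^* * a * x + x^* * b * y + y^* * b^* * x + y^* * c * y)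
   = (b^* * x + c * y) * (b^* * x + c * y)^* + (a * c - b * b^*) * (x * x^*).
  by rewrite !(rmorphD, rmorphM) /= conjCK (conj_Creal (gtr0_real c0)); ring.
by apply: addr_ge0; [|apply: mulr_ge0 => //]; exact: mul_conjC_ge0.
Qed.

Context {R : realType}.
Local Notation C := R[i].
Implicit Types X Y M : 'M[C]_2.

Lemma hermitian2E M : M^t* = M -> M 1 0 = (M 0 1)^*%R.
Proof. by move=> MH; rewrite -{1}MH !mxE. Qed.

Lemma psd2_diag_det M :
  M^t* = M -> 0 <= M 0 0 -> 0 <= M 1 1 -> 0 <= \det M -> psd M.
Proof.
move=> MH M0 M1; rewrite det_mx22 (hermitian2E MH) => dM v.
rewrite mxE !big_ord_recl big_ord0 !mxE !big_ord_recl !big_ord0 !mxE.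
have -> : lift ord0 ord0 = 1 :> 'I_2 by apply/val_inj.
have -> : ord0 = 0 :> 'I_2 by apply/val_inj.
rewrite (hermitian2E MH).
rewrite [X in 0 <= X](_ : _ = (v 0 0)^* * M 0 0 * v 0 0
  + (v 0 0)^* * M 0 1 * v 1 0 + (v 1 0)^* * (M 0 1)^* * v 0 0
  + (v 1 0)^* * M 1 1 * v 1 0)%R; last by ring.
exact: quadratic_form2_ge0.
Qed.

Lemma psd2_det M : M^t* = M -> 0 < M 1 1 -> 0 <= \det M -> psd M.
Proof.
move=> MH M1 dM; apply: psd2_diag_det (ltW M1) (dM) => //.
rewrite -(pmulr_lge0 _ M1); move: dM.
rewrite det_mx22 (hermitian2E MH) subr_ge0; apply: le_trans.
exact: mul_conjC_ge0.
Qed.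

Lemma hermitian_diag_real n (M : 'M[C]_n) i : M^t* = M -> M i i \is Num.real.
Proof. by move=> MH; apply/CrealP; rewrite -{2}MH !mxE. Qed.

Lemma mxtrace2 M : \tr M = M 0 0 + M 1 1.
Proof.
rewrite /mxtrace !big_ord_recl big_ord0 addr0.
by congr (_ + M _ _); apply/val_inj.
Qed.

(** A nonnegative determinant makes the product of the diagonal entries nonnegative; with a
    nonnegative trace neither entry can then be negative. *)
Lemma psd2_trace_det M : M^t* = M -> 0 <= \tr M -> 0 <= \det M -> psd M.
Proof.
move=> MH tM dM; have d0 : 0 <= M 0 0 * M 1 1.
  move: dM; rewrite det_mx22 (hermitian2E MH) subr_ge0; apply: le_trans.
  exact: mul_conjC_ge0.
have r0 := hermitian_diag_real 0 MH; have r1 := hermitian_diag_real 1 MH.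
rewrite mxtrace2 in tM.
suff [] : 0 <= M 0 0 /\ 0 <= M 1 1 by move=> *; exact: psd2_diag_det.
have [p0|n0] := real_leP (real0 _) r0;
  have [p1|n1] := real_leP (real0 _) r1; split=> //.
- move: d0; move: p0; rewrite le_eqVlt => /predU1P[z0|p0].
    by move: tM; rewrite -z0 add0r (lt_geF n1).
  by rewrite pmulr_rge0 // (lt_geF n1).
- move: d0; move: p1; rewrite le_eqVlt => /predU1P[z1|p1].
    by move: tM; rewrite -z1 addr0 (lt_geF n0).
  by rewrite pmulr_lge0 // (lt_geF n0).
- by have := ltrD n0 n1; rewrite addr0 => /lt_geF; rewrite tM.
- by have := ltrD n0 n1; rewrite addr0 => /lt_geF; rewrite tM.
Qed.

Lemma det_traceless_le0 M : M^t* = M -> \tr M = 0 -> \det M <= 0.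
Proof.
move=> MH /eqP; rewrite mxtrace2 addrC addr_eq0 det_mx22 => /eqP ->.
rewrite (hermitian2E MH) mulrN subr_le0.
apply: le_trans (mul_conjC_ge0 _); rewrite oppr_le0 -expr2.
by rewrite real_exprn_even_ge0 // hermitian_diag_real.
Qed.

Lemma psd2_rank1 M : psd M -> \det M = 0 -> exists w : 'cV[C]_2, M = w *m w^t*.
Proof.
move=> Mp dM; apply: psd_rank1 => //; rewrite -ltnS ltn_neqAle rank_leq_row andbT.
apply/negP => rM; have : M \in unitmx by rewrite -row_free_unit.
by rewrite unitmxE dM unitr0.
Qed.

(** The coefficient of t^2 is the determinant of a matrix of rank at most one, so the determinant is
    affine in [t]; its value at 1 fixes the slope. *)
Lemma det_sub_rank1 X (y : 'cV[C]_2) t :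
  \det (X - t *: (y *m y^t*)) = \det X - t * (\det X - \det (X - y *m y^t*)).
Proof. by rewrite !det_mx22 !mxE !big_ord1 !mxE; ring. Qed.

Lemma two_cones_boundary X (y : 'cV[C]_2) : psd X -> \tr X = \tr (y *m y^t*) ->
  exists S (x z : 'cV[C]_2),
    [/\ psd S, X - S = x *m x^t* & y *m y^t* - S = z *m z^t*].
Proof.
(* [S = t y y^*]: the determinant of [X - t y y^*] is affine in [t], nonnegative
   at [t = 0], and nonpositive at [t = 1], where the matrix is traceless. *)
move=> Xp trE; set Y := y *m y^t*; pose k := \det X - \det (X - Y).
have Yp : psd Y := psd_gram y.
have dX := det_psd Xp.
have dXk : \det X <= k.
  rewrite lerDl oppr_ge0 det_traceless_le0 //.
    by rewrite adjmxB !psd_adj.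
  by rewrite linearB /= trE subrr.
have k0 := le_trans dX dXk.
have [t [t0 t1 tk]] : exists t, [/\ 0 <= t, t <= 1 & \det X - t * k = 0].
  have [k_eq0|k_neq0] := eqVneq k 0.
    exists 0; split=> //; rewrite mul0r subr0; apply/le_anti.
    by rewrite dX -k_eq0 dXk.
  exists (\det X / k); rewrite divfK // subrr; split=> //.
    by rewrite divr_ge0.
  by rewrite ler_pdivrMr ?mul1r // lt_def k_neq0.
have tr : t^*%R = t by rewrite conj_Creal // ger0_real.
have dS : \det (X - t *: Y) = 0 by rewrite det_sub_rank1.
have Sp : psd (X - t *: Y).
  apply: psd2_trace_det; last by rewrite dS.
    by rewrite adjmxB adjmxZ tr !psd_adj.
  rewrite linearB linearZ /= trE -/Y -[X in X - _]mul1r -mulrBl.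
  rewrite mulr_ge0 ?subr_ge0 // mxtrace2.
  by rewrite addr_ge0 ?psd_diag.
have [x xE] := psd2_rank1 Sp dS.
exists (t *: Y), x, (sqrtC (1 - t) *: y); split; [exact: psdZ|exact: xE|].
rewrite adjmxZ -scalemxAl -scalemxAr scalerA conj_Creal; last first.
  by rewrite ger0_real // sqrtC_ge0 subr_ge0.
by rewrite -expr2 sqrtCK scalerBl scale1r.
Qed.

Lemma delta_psd (i : 'I_2) : psd (delta_mx i i : 'M[C]_2).
Proof.
have := psd_gram (delta_mx i 0 : 'cV[C]_2).
by rewrite adjmx_delta mul_delta_mx.
Qed.

Lemma psd_diag1_gt0 M : psd M -> \det M != 0 -> 0 < M 1 1.
Proof.
move=> Mp dM; rewrite lt_def psd_diag // andbT; apply: contra_neq dM => M1.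
apply/le_anti; rewrite det_psd // andbT det_mx22 M1 mulr0 sub0r.
by rewrite (hermitian2E (psd_adj Mp)) oppr_le0 mul_conjC_ge0.
Qed.

(* In the Lorentzian space of Hermitian matrices, [X] and [Y] can be moved by the
   same past-directed vector onto the boundary of the light cone. *)
Lemma two_cones X Y : psd X -> psd Y -> \tr X = \tr Y ->
  exists S (x z : 'cV[C]_2), [/\ psd S, X - S = x *m x^t* & Y - S = z *m z^t*].
Proof.
move=> Xp Yp trE.
have det_case X' Y' : psd X' -> psd Y' -> \tr X' = \tr Y' -> \det Y' = 0 ->
  exists S (x z : 'cV[C]_2), [/\ psd S, X' - S = x *m x^t* & Y' - S = z *m z^t*].
  move=> X'p Y'p trE' /(psd2_rank1 Y'p)[y Y'E].
  by rewrite Y'E in trE' *; exact: two_cones_boundary.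
have [dY|dY] := eqVneq (\det Y) 0; first exact: det_case.
have [dX|dX] := eqVneq (\det X) 0.
  by have [S [x [z []]]] := det_case Y X Yp Xp (esym trE) dX; exists S, z, x.
(* For an invertible psd [M], [\det M / M 1 1] is the largest multiple of E00 that can be subtracted
   with [M] staying psd. Assuming that [Y] reaches the boundary first, the subtraction reduces to
   [det_case]. *)
wlog le_t : X Y Xp Yp trE dX dY / \det Y / Y 1 1 <= \det X / X 1 1.
  move=> H.
  have: \det Y / Y 1 1 >=< \det X / X 1 1.
    by apply: real_comparable; rewrite ger0_real // divr_ge0 ?det_psd ?psd_diag.
  case/orP=> le_t; first exact: H.
  by have [S [x [z []]]] := H Y X Yp Xp (esym trE) dY dX le_t; exists S, z, x.
have X1 := psd_diag1_gt0 Xp dX; have Y1 := psd_diag1_gt0 Yp dY.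
set t := \det Y / Y 1 1 in le_t.
have t0 : 0 <= t by rewrite divr_ge0 ?det_psd ?psd_diag.
pose T : 'M[C]_2 := t *: delta_mx 0 0.
have Tp : psd T := psdZ t0 (delta_psd 0).
have detT M : \det (M - T) = \det M - t * M 1 1.
  by rewrite !det_mx22 !mxE /=; ring.
have diagT M : (M - T) 1 1 = M 1 1 by rewrite !mxE /= mulr0 subr0.
have XTp : psd (X - T).
  apply: psd2_det; rewrite ?diagT ?detT // ?adjmxB ?psd_adj //.
  by rewrite subr_ge0 -ler_pdivlMr.
have dYT : \det (Y - T) = 0 by rewrite detT divfK ?subrr ?gt_eqF.
have YTp : psd (Y - T).
  by apply: psd2_det; rewrite ?diagT ?dYT // ?adjmxB ?psd_adj.
have trT : \tr (X - T) = \tr (Y - T) by rewrite !linearB /= trE.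
have [S [x [z [Sp xE zE]]]] := det_case _ _ XTp YTp trT dYT.
exists (T + S), x, z; split; first exact: psdD.
  by rewrite opprD addrA.
by rewrite opprD addrA.
Qed.
End Planar.

(** * Normal dilations *)

Section NormalDilation.
Local Open Scope sesquilinear_scope.
Context {C : numClosedFieldType}.

Lemma cV2_dot (x y : 'cV[C]_2) :
  (x^t* *m y) 0 0 = (x 0 0)^* * y 0 0 + (x 1 0)^* * y 1 0.
Proof.
rewrite mxE !big_ord_recl big_ord0 !mxE addr0.
by congr (_ + (x _ _)^* * y _ _); apply/val_inj.
Qed.

Lemma ord2_ind (P : 'I_2 -> Prop) : P 0 -> P 1 -> forall i, P i.
Proof.
move=> P0 P1 -[[|[|//]] lt_i2].
  by rewrite (_ : Ordinal _ = 0) //; apply/val_inj.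
by rewrite (_ : Ordinal _ = 1) //; apply/val_inj.
Qed.

(** Parallel vectors of equal length differ by a phase, which cancels in the outer product.
    Multiplying both sides by the common squared norm avoids choosing that phase. *)
Lemma parallel_proj_eq (x y : 'cV[C]_2) :
  x 0 0 * y 1 0 - x 1 0 * y 0 0 = 0 -> (x^t* *m x) 0 0 = (y^t* *m y) 0 0 ->
  x *m x^t* = y *m y^t*.
Proof.
move=> xy xx; have [r0|r0] := eqVneq ((x^t* *m x) 0 0) 0.
  move: (r0); rewrite xx => /eqP; rewrite dotmx_eq0 => /eqP ->.
  by move: r0 => /eqP; rewrite dotmx_eq0 => /eqP ->.
have swap i k : x i 0 * y k 0 = x k 0 * y i 0.
  move/eqP: xy; rewrite subr_eq0 => /eqP xy.
  by elim/ord2_ind: i; elim/ord2_ind: k; rewrite ?xy // mulrC.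
apply/matrixP => i j; rewrite !mxE !big_ord1 !mxE.
apply: (mulIf r0); rewrite [in RHS]cV2_dot xx cV2_dot.
have term k : x i 0 * (x j 0)^* * ((y k 0)^* * y k 0) =
              y i 0 * (y j 0)^* * ((x k 0)^* * x k 0).
  transitivity ((x i 0 * y k 0) * (x j 0 * y k 0)^*).
    by rewrite rmorphM; ring.
  by rewrite !(swap _ k) rmorphM; ring.
by rewrite !mulrDr !term.
Qed.

(** Together with its conjugate, the equation is a linear system in [z] and [z^*] with determinant
    [s * s^* - r * r]; the witness is Cramer's rule. *)
Lemma sesquilinear_system_solvable (s r g : C) :
  r^* = r -> s * s^* - r * r != 0 -> exists z, z * s - z^* * r = g.
Proof.
move=> rr D0; pose D := s * s^* - r * r.
have DD : D^* = D by rewrite rmorphB !rmorphM /= rr conjCK [X in X - _]mulrC.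
exists ((s^* * g + r * g^*) / D).
have -> : ((s^* * g + r * g^*) / D)^* = (s * g^* + r * g) / D.
  by rewrite rmorphM /= fmorphV /= DD rmorphD !rmorphM /= !conjCK rr.
by rewrite /D; field.
Qed.

Lemma cV2_dot_inj (x y w : 'cV[C]_2) : x 0 0 * y 1 0 - x 1 0 * y 0 0 != 0 ->
  (x^t* *m w) 0 0 = 0 -> (y^t* *m w) 0 0 = 0 -> w = 0.
Proof.
rewrite -conjC_eq0 rmorphB !rmorphM /= => d0; rewrite !cV2_dot => xw yw.
apply/colP; apply: ord2_ind; rewrite mxE; apply: (mulfI d0); rewrite mulr0.
  transitivity ((y 1 0)^* * ((x 0 0)^* * w 0 0 + (x 1 0)^* * w 1 0) -
    (x 1 0)^* * ((y 0 0)^* * w 0 0 + (y 1 0)^* * w 1 0)); first by ring.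
  by rewrite xw yw !mulr0 subrr.
transitivity ((x 0 0)^* * ((y 0 0)^* * w 0 0 + (y 1 0)^* * w 1 0) -
  (y 0 0)^* * ((x 0 0)^* * w 0 0 + (x 1 0)^* * w 1 0)); first by ring.
by rewrite xw yw !mulr0 subrr.
Qed.

(* Pairing the vector equation with [x] and with [y] gives two scalar equations;
   the hypothesis on [B] makes the second one minus the conjugate of the first. *)
Lemma dilation_corner (B : 'M[C]_2) (x y : 'cV[C]_2) :
  x 0 0 * y 1 0 - x 1 0 * y 0 0 != 0 ->
  B *m B^t* + x *m x^t* = B^t* *m B + y *m y^t* ->
  exists z, B *m y + z^* *: x = B^t* *m x + z *: y.
Proof.
move=> d0 BE; pose H := B *m B^t* - B^t* *m B.
(* The self-commutator [H] has trace zero, and so has [H *m B]. Read on the right-hand side, these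
   two facts give [rE] and [qE]. *)
have HE : H = y *m y^t* - x *m x^t*.
  by apply/eqP; rewrite subr_eq addrAC eq_sym subr_eq addrC eq_sym BE addrC.
have trdot (M : 'M[C]_2) (u : 'cV[C]_2) :
    (u^t* *m M *m u) 0 0 = \tr (u *m u^t* *m M).
  by rewrite -[u *m _ *m M]mulmxA mxtrace_mulC trace_mx11.
pose r := (x^t* *m x) 0 0; pose s := (x^t* *m y) 0 0.
pose p := (x^t* *m B *m y) 0 0; pose q := (x^t* *m B *m x) 0 0.
have rE : (y^t* *m y) 0 0 = r.
  have := trdot 1%:M x; have := trdot 1%:M y; rewrite !mulmx1 /r => -> ->.
  apply/eqP; rewrite -subr_eq0 -linearB -HE linearB /= mxtrace_mulC.
  by rewrite subrr.
have qE : (y^t* *m B *m y) 0 0 = q.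
  rewrite /q !trdot; apply/eqP; rewrite -subr_eq0 -linearB -mulmxBl -HE /H.
  rewrite mulmxBl linearB /= -[X in _ - \tr X]mulmxA [X in _ - X]mxtrace_mulC.
  by rewrite [X in X - _]mxtrace_mulC mulmxA subrr.
have rr : r^* = r by rewrite conj_Creal // ger0_real // dotmx_ge0.
(* Lagrange's identity: the gap in the Cauchy-Schwarz inequality is the squared modulus of the
   determinant of [x] and [y]. *)
have D0 : s * s^* - r * r != 0.
  have -> : s * s^* - r * r = - ((x 0 0 * y 1 0 - x 1 0 * y 0 0) *
      (x 0 0 * y 1 0 - x 1 0 * y 0 0)^*).
    rewrite -{1}rE /s /r !cV2_dot !(rmorphB, rmorphD, rmorphM) /= !conjCK; ring.
  by rewrite oppr_eq0 mul_conjC_eq0.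
have [z zE] := sesquilinear_system_solvable (p - q^*) rr D0.
exists z; apply/eqP; rewrite -subr_eq0 opprD addrACA; apply/eqP.
have conjdot (M : 'M[C]_2) (u v : 'cV[C]_2) :
    (u^t* *m M^t* *m v) 0 0 = ((v^t* *m M *m u) 0 0)^*.
  by rewrite -adjmx11 !adjmxM trmxCK mulmxA.
have ys : (y^t* *m x) 0 0 = s^*.
  by rewrite /s -adjmx11 adjmxM trmxCK.
have expand (u : 'cV[C]_2) :
    (u^t* *m (B *m y - B^t* *m x + (z^* *: x - z *: y))) 0 0 =
    (u^t* *m B *m y) 0 0 - (u^t* *m B^t* *m x) 0 0
     + (z^* * (u^t* *m x) 0 0 - z * (u^t* *m y) 0 0).
  rewrite mulmxDr !mulmxBr -!scalemxAr !mulmxA addmx11.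
  by rewrite -!scaleN1r !addmx11 !scalemx11 !mulN1r.
apply: (cV2_dot_inj d0); rewrite expand conjdot.
  by rewrite -/p -/q -/r -/s -zE; ring.
rewrite qE -/p ys rE.
have /(congr1 Num.conj) := zE.
rewrite !rmorphB !rmorphM /= !conjCK rr => h.
transitivity (- ((p^* - q) - (z^* * s^* - z * r))); first by ring.
by rewrite h; ring.
Qed.
End NormalDilation.

Section Dilation.
Local Open Scope sesquilinear_scope.
Context {R : realType}.
Local Notation C := R[i].

Lemma adjmx_block (B : 'M[C]_2) (x y : 'cV[C]_2) (z : C) :
  (block_mx B x (y^t*) z%:M)^t* =
    block_mx (B^t*) y (x^t*) (z^*%R)%:M.
Proof. by rewrite tr_block_mx map_block_mx trmxCK tr_scalar_mx map_scalar_mx. Qed.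

(** Normality of the bordered matrix amounts to three equations: [BE] for the corner, equality of
    the norms of [x] and [y], and the mixed equation of [dilation_corner]. The first comes from
    [two_cones], and a trace gives the second. *)
Lemma normal_dilation (B D : 'M[C]_2) :
  psd (D - B *m B^t*) -> psd (D - B^t* *m B) ->
  exists (x y : 'cV[C]_2) (z : C), block_mx B x (y^t*) z%:M \is normalmx /\
    psd (D - (B^t* *m B + y *m y^t*)).
Proof.
move=> Pp Qp.
have trE : \tr (D - B *m B^t*) = \tr (D - B^t* *m B).
  by rewrite !linearB /= mxtrace_mulC.
have [S [x [y [Sp xE yE]]]] := two_cones Pp Qp trE.
have BE : B *m B^t* + x *m x^t* = B^t* *m B + y *m y^t*.
  by rewrite -xE -yE ![_ + (_ - _)]addrC ![_ - _ - S]addrAC !subrK.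
have nE : (x^t* *m x) 0 0 = (y^t* *m y) 0 0.
  rewrite -!trace_mx11 ![\tr (_^t* *m _)]mxtrace_mulC -xE -yE.
  by rewrite [LHS]linearB [RHS]linearB /= trE.
(* If [x] and [y] are parallel, their outer products agree, so [B] is itself normal and a zero
   border suffices. *)
have [xy0|xy0] := eqVneq (x 0 0 * y 1 0 - x 1 0 * y 0 0) 0.
  have BN : B *m B^t* = B^t* *m B.
    by move: BE; rewrite (parallel_proj_eq xy0 nE) => /addIr.
  exists 0, 0, 0; rewrite mul0mx addr0; split=> //.
  apply/normalmxP; rewrite adjmx_block !mulmx_block BN.
  rewrite !trmx0 !map_mx0 !mul0mx !mulmx0 !addr0 !add0r.
  by rewrite conjC0 raddf0 !mulmx0 ?mul0mx.
have [z zE] := dilation_corner xy0 BE.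
exists x, y, z; split; last by rewrite opprD addrA -yE subKr.
have zE' : y^t* *m B^t* + z *: x^t* = x^t* *m B + z^*%R *: y^t*.
  have := congr1 (fun M : 'cV[C]_2 => M^t*) zE.
  by rewrite !adjmxD !adjmxZ !adjmxM !trmxCK conjCK.
have nE' : x^t* *m x = y^t* *m y by rewrite [LHS]mx11_scalar nE -mx11_scalar.
apply/normalmxP; rewrite adjmx_block !mulmx_block BE.
rewrite !mul_mx_scalar !mul_scalar_mx zE zE' nE'.
by rewrite -!mul_scalar_mx -!scalar_mxM [z * _]mulrC.
Qed.
End Dilation.

(** * Kraus decompositions *)

Section Kraus.
Local Open Scope sesquilinear_scope.
Context {R : realType}.
Local Notation C := R[i].
Implicit Types (Phi Psi : superop R) (A B : 'M[C]_2).

Lemma superop_ext Phi Psi :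
  (forall i j, Phi (delta_mx i j) = Psi (delta_mx i j)) -> Phi = Psi.
Proof.
move=> E; apply/lfunP => X; rewrite [X]matrix_sum_delta !linear_sum.
apply: eq_bigr => i _; rewrite !linear_sum; apply: eq_bigr => j _.
by rewrite !linearZ /= E.
Qed.

Lemma comp_lfun_suml I (r : seq I) (F : I -> superop R) Psi :
  (\sum_(i <- r) F i \o Psi)%VF = \sum_(i <- r) (F i \o Psi)%VF.
Proof.
apply/lfunP => X; rewrite comp_lfunE !sum_lfunE.
by apply: eq_bigr => i _; rewrite comp_lfunE.
Qed.

Lemma comp_lfun_sumr I (r : seq I) (F : I -> superop R) Psi :
  (Psi \o \sum_(i <- r) F i)%VF = \sum_(i <- r) (Psi \o F i)%VF.
Proof.
apply/lfunP => X; rewrite comp_lfunE !sum_lfunE linear_sum.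
by apply: eq_bigr => i _; rewrite comp_lfunE.
Qed.

Lemma Ad_comp A B : (Ad A \o Ad B)%VF = Ad (A *m B).
Proof. by apply/lfunP => X; rewrite comp_lfunE !AdE adjmxM !mulmxA. Qed.

Lemma Ad1 : Ad (1%:M : 'M[C]_2) = \1%VF.
Proof. by apply/lfunP => X; rewrite AdE id_lfunE adjmx1 mul1mx mulmx1. Qed.

Lemma Ad0 : Ad (0 : 'M[C]_2) = 0.
Proof. by apply/lfunP => X; rewrite AdE !mul0mx zero_lfunE. Qed.

Lemma transpK : (transp R \o transp R)%VF = \1%VF.
Proof. by apply/lfunP => X; rewrite comp_lfunE !transpE trmxK id_lfunE. Qed.

Lemma transp_Ad A : (transp R \o Ad A \o transp R)%VF = Ad (map_mx Num.conj A).
Proof.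
apply/lfunP => X; rewrite !comp_lfunE !transpE !AdE !trmx_mul trmxK mulmxA.
by congr (_ *m _ *m _); apply/matrixP => i j; rewrite !mxE // conjCK.
Qed.

Lemma superpositive0 k : superpositive_cone R k 0.
Proof. by exists 0%N, (fun=> 0); split=> [[]//|]; rewrite big_ord0. Qed.

Lemma superpositiveD k Phi Psi : superpositive_cone R k Phi ->
  superpositive_cone R k Psi -> superpositive_cone R k (Phi + Psi).
Proof.
move=> [m [A [rA ->]]] [n [B [rB ->]]].
exists (m + n)%N, (fun i => match split i with inl j => A j | inr j => B j end).
split=> [i|]; first by case: split.
rewrite big_split_ord.
apply: (congr2 (fun F G : superop R => F + G)); apply: eq_bigr => i _.
  by rewrite (unsplitK (inl i)).
by rewrite (unsplitK (inr i)).
Qed.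

Lemma superpositive_sum k I (r : seq I) (P : pred I) (F : I -> superop R) :
  (forall i, superpositive_cone R k (F i)) ->
  superpositive_cone R k (\sum_(i <- r | P i) F i).
Proof.
move=> spF; elim/big_rec: _ => [|i Phi _]; first exact: superpositive0.
exact: superpositiveD.
Qed.

Lemma superpositive_Ad k A : (\rank A <= k)%N -> superpositive_cone R k (Ad A).
Proof. by move=> rA; exists 1%N, (fun=> A); rewrite big_ord1. Qed.

Lemma superpositive_subset k l : (k <= l)%N ->
  superpositive_cone R k `<=` superpositive_cone R l.
Proof.
move=> kl Phi [n [A [rA ->]]]; exists n, A; split=> // i.
exact: leq_trans (rA i) kl.
Qed.

Lemma superpositive_comp k l Phi Psi : superpositive_cone R k Phi ->
  superpositive_cone R l Psi -> superpositive_cone R (minn k l) (Phi \o Psi)%VF.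
Proof.
move=> [m [A [rA ->]]] [n [B [rB ->]]]; rewrite comp_lfun_suml.
apply: superpositive_sum => i; rewrite comp_lfun_sumr.
apply: superpositive_sum => j; rewrite Ad_comp; apply: superpositive_Ad.
rewrite leq_min (leq_trans (mxrankM_maxl _ _) (rA i)).
by rewrite (leq_trans (mxrankM_maxr _ _) (rB j)).
Qed.

Lemma superpositive_conj_transp k Phi : superpositive_cone R k Phi ->
  superpositive_cone R k (transp R \o Phi \o transp R)%VF.
Proof.
move=> [n [A [rA ->]]]; rewrite comp_lfun_sumr comp_lfun_suml.
apply: superpositive_sum => i; rewrite transp_Ad; apply: superpositive_Ad.
by rewrite mxrank_map.
Qed.

Lemma rank1_outer m n (A : 'M[C]_(m, n)) : (\rank A <= 1)%N ->
  exists (x : 'cV[C]_m) (y : 'cV[C]_n), A = x *m y^t*.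
Proof.
rewrite -{2}(mulmx_base A); move: (col_base A) (row_base A).
case: (\rank A) => [|[|//]] c r _.
  by exists 0, 0; rewrite (flatmx0 r) mulmx0 mul0mx.
by exists c, (r^t*); rewrite trmxCK.
Qed.

Lemma rank_outer m n (x : 'cV[C]_m) (y : 'cV[C]_n) : (\rank (x *m y^t*) <= 1)%N.
Proof. exact: leq_trans (mxrankM_maxl _ _) (rank_leq_col _). Qed.

(** Both maps multiply x x^* by a number, and the number y^* X^T y is its own transpose: transposing
    the argument only conjugates [y]. *)
Lemma Ad_outer_transp (x y : 'cV[C]_2) :
  (Ad (x *m y^t*) \o transp R)%VF = Ad (x *m y^T).
Proof.
apply/lfunP => X; rewrite comp_lfunE [LHS]AdE [RHS]AdE transpE.
have key : y^t* *m X^T *m y = y^T *m X *m (y^T)^t*.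
  have trmx11 (M : 'M[C]_1) : M^T = M by apply/matrixP => i j; rewrite mxE !ord1.
  rewrite -[LHS]trmx11 !trmx_mul !trmxK mulmxA; congr (_ *m _ *m _).
  by apply/matrixP => i j; rewrite !mxE.
transitivity (x *m (y^t* *m X^T *m y) *m x^t*).
  by rewrite adjmxM trmxCK !mulmxA.
by rewrite key adjmxM !mulmxA.
Qed.

Lemma superpositive1_transp Phi : superpositive_cone R 1 Phi ->
  superpositive_cone R 1 (Phi \o transp R)%VF.
Proof.
move=> [n [A [rA ->]]]; rewrite comp_lfun_suml; apply: superpositive_sum => i.
have [x [y ->]] := rank1_outer (rA i).
rewrite Ad_outer_transp; apply: superpositive_Ad.
exact: leq_trans (mxrankM_maxl _ _) (rank_leq_col _).
Qed.

Lemma Ad_delta A i j : Ad A (delta_mx i j) = col i A *m (col j A)^t*.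
Proof.
rewrite AdE -(mul_delta_mx (0 : 'I_1)) mulmxA -colE -mulmxA; congr (_ *m _).
by apply/rowP => b; rewrite -rowE !mxE.
Qed.

(** * Ampliations, Choi matrices and Choi's theorem *)

Lemma mxtens_blockE k (X : 'M[C]_(k * 2)) i j a b :
  mxtens_block X i j a b = X (mxtens_index (i, a)) (mxtens_index (j, b)).
Proof. by rewrite mxE. Qed.

Lemma id_tens_block k Phi (X : 'M[C]_(k * 2)) i j :
  mxtens_block (id_tens Phi X) i j = Phi (mxtens_block X i j).
Proof.
apply/matrixP => a b; rewrite mxtens_blockE /id_tens summxE.
rewrite (bigD1 i) //= [X in _ + X]big1 ?addr0 => [|l /negPf li].
  rewrite summxE (bigD1 j) //= [X in _ + X]big1 ?addr0 => [|l /negPf lj].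
    by rewrite tensmxE mxE !eqxx mul1r.
  by rewrite tensmxE mxE [j == l]eq_sym lj andbF mul0r.
by rewrite summxE big1 // => l' _; rewrite tensmxE mxE [i == l]eq_sym li mul0r.
Qed.

(** The unnormalised maximally entangled vector. Its outer product has the matrix units as blocks,
    which presents the Choi matrix as the image of a psd matrix under the ampliation of order
    two. *)
Definition entangled : 'cV[C]_(2 * 2) :=
  \col_p ((mxtens_unindex p).1 == (mxtens_unindex p).2)%:R.

Lemma entangled_block i j :
  mxtens_block (entangled *m entangled^t*) i j = delta_mx i j.
Proof.
apply/matrixP => a b; rewrite !mxE big_ord1 !mxE !mxtens_indexK /=.
by rewrite conjC_nat -natrM mulnb [i == a]eq_sym [j == b]eq_sym.
Qed.

Lemma choi_id_tens Phi : choi Phi = id_tens Phi (entangled *m entangled^t*).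
Proof. by do 2!apply: eq_bigr => ? _; rewrite entangled_block. Qed.

Lemma choiE Phi i j a b : choi Phi (mxtens_index (i, a)) (mxtens_index (j, b)) =
  Phi (delta_mx i j) a b.
Proof. by rewrite choi_id_tens -mxtens_blockE id_tens_block entangled_block. Qed.

Lemma choi_psd Phi : k_positive 2 Phi -> psd (choi Phi).
Proof. by move=> Phi2; rewrite choi_id_tens; exact/Phi2/psd_gram. Qed.

(** In [choi] the first tensor factor carries the argument of the map, hence the first index becomes
    the column index. *)
Definition unvec (w : 'cV[C]_(2 * 2)) : 'M[C]_2 :=
  \matrix_(a, i) w (mxtens_index (i, a)) 0.

(** The dictionary between Gram decompositions of the Choi matrix and Kraus decompositions of the
    map: w w^* is the Choi matrix of [Ad (unvec w)]. *)
Lemma choi_eq_gram Phi I (r : seq I) (w : I -> 'cV[C]_(2 * 2)) :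
  choi Phi = \sum_(k <- r) w k *m (w k)^t* <->
  Phi = \sum_(k <- r) Ad (unvec (w k)).
Proof.
split=> [E|->].
  apply: superop_ext => i j; apply/matrixP => a b; rewrite -choiE E.
  rewrite sum_lfunE !summxE; apply: eq_bigr => k _.
  by rewrite Ad_delta !mxE !big_ord1 !mxE.
apply/matrixP => p q; case: (mxtens_indexP p) => i a.
case: (mxtens_indexP q) => j b; rewrite choiE sum_lfunE !summxE.
by apply: eq_bigr => k _; rewrite Ad_delta !mxE !big_ord1 !mxE.
Qed.

Lemma kraus_decomposition Phi : psd (choi Phi) -> superpositive_cone R 2 Phi.
Proof.
move=> /psd_gram_exists[W WE].
have /choi_eq_gram-> : choi Phi = \sum_k col k W *m (col k W)^t*.
  rewrite WE; apply/matrixP => p q; rewrite mxE summxE.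
  by apply: eq_bigr => k _; rewrite !mxE big_ord1 !mxE.
by apply: superpositive_sum => k; apply: superpositive_Ad; rewrite rank_leq_row.
Qed.

Lemma id_tensD k Phi Psi (X : 'M[C]_(k * 2)) :
  id_tens (Phi + Psi) X = id_tens Phi X + id_tens Psi X.
Proof.
rewrite -big_split; apply: eq_bigr => i _; rewrite -big_split.
apply: eq_bigr => j _; apply/matrixP => p q; rewrite add_lfunE.
by rewrite !mxE mulrDr.
Qed.

Lemma id_tens0 k (X : 'M[C]_(k * 2)) : id_tens 0 X = 0.
Proof.
rewrite /id_tens big1 // => i _; rewrite big1 // => j _.
by rewrite zero_lfunE tensmx0.
Qed.

Lemma mxtens_block_inj k (X Y : 'M[C]_(k * 2)) :
  (forall i j, mxtens_block X i j = mxtens_block Y i j) -> X = Y.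
Proof.
move=> E; apply/matrixP => p q; case: (mxtens_indexP p) => i a.
by case: (mxtens_indexP q) => j b; rewrite -!mxtens_blockE E.
Qed.

Lemma id_tens_Ad k A (X : 'M[C]_(k * 2)) :
  id_tens (Ad A) X = (1%:M *t A) *m X *m (1%:M *t A)^t*.
Proof.
(* The ampliation of the identity map reassembles [X] from its blocks. *)
have XE : X = \sum_i \sum_j delta_mx i j *t mxtens_block X i j.
  rewrite -[LHS](_ : id_tens \1%VF X = X).
    by do 2!apply: eq_bigr => ? _; rewrite id_lfunE.
  by apply: mxtens_block_inj => i j; rewrite id_tens_block id_lfunE.
rewrite [in RHS]XE mulmx_sumr mulmx_suml; apply: eq_bigr => i _.
rewrite mulmx_sumr mulmx_suml; apply: eq_bigr => j _.
rewrite trmx_tens map_mxT !tensmx_mul mul1mx AdE.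
by rewrite -/(trmx _ ^ _) adjmx1 mulmx1.
Qed.

Lemma superpositive_k_positive k l :
  superpositive_cone R k `<=` k_positive_cone R l.
Proof.
move=> _ [n [A [_ ->]]] X Xp; elim/big_rec: _ => [|i Phi _ IH].
  by rewrite id_tens0; exact: psd0.
by rewrite id_tensD; apply: psdD IH; rewrite id_tens_Ad; exact: psd_congr.
Qed.

(** Choi's theorem: 2-positivity makes the Choi matrix psd, the columns of a Gram factor are Kraus
    operators, and a Kraus form is positive at every level. *)
Lemma k_positive2E : k_positive_cone R 2 = superpositive_cone R 2.
Proof.
apply/seteqP; split; last exact: superpositive_k_positive.
by move=> Phi /choi_psd/kraus_decomposition.
Qed.

Lemma cp_coneE : cp_cone R = superpositive_cone R 2.
Proof.
apply/seteqP; split=> [Phi /(_ 2)|Phi SPhi k]; first by rewrite -k_positive2E.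
exact: superpositive_k_positive SPhi.
Qed.
End Kraus.

(** * The Peres-Horodecki criterion *)

Section PPT.
Local Open Scope sesquilinear_scope.
Context {R : realType}.
Local Notation C := R[i].
Implicit Types (Phi Psi : superop R) (A B D : 'M[C]_2) (u v : 'cV[C]_2).

Lemma mul_diag_adj m n (F : 'M[C]_(m, n)) (d : 'rV[C]_n) :
  F *m diag_mx d *m F^t* = \sum_i d 0 i *: (col i F *m (col i F)^t*).
Proof.
apply/matrixP => a b; rewrite mxE summxE; apply: eq_bigr => i _.
by rewrite mul_mx_diag !mxE big_ord1 !mxE -mulrA mulrCA.
Qed.

(** The [f i] are the first [m] coordinates of an orthonormal eigenbasis and the [z i] the
    eigenvalues. The identity, [N] and N^* N are diagonal in that basis, so their corners are
    combinations of the same outer products. *)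
Lemma normal_compression m n (N : 'M[C]_(m + n)) : N \is normalmx ->
  exists (f : 'I_(m + n) -> 'cV[C]_m) (z : 'I_(m + n) -> C),
    [/\ 1%:M = \sum_i f i *m (f i)^t*,
        ulsubmx N = \sum_i z i *: (f i *m (f i)^t*) &
        ulsubmx (N^t* *m N) = \sum_i ((z i)^* * z i)%R *: (f i *m (f i)^t*)].
Proof.
move=> /normalmx_unitary_diag[P PU [d NE]].
pose F := usubmx (P^t*).
have ulE (X : 'M[C]_(m + n)) : ulsubmx (P^t* *m X *m P) = F *m X *m F^t*.
  rewrite -{2}[P]trmxCK -{1}[P^t*]vsubmxK -/F mul_col_mx.
  by rewrite -{2}[P^t*]vsubmxK tr_col_mx map_row_mx mul_col_row block_mxKul.
have PP : P^t* *m P = 1%:M.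
  by rewrite -{2}[P]trmxCK; apply/unitarymxP; rewrite trmxC_unitary.
exists (fun i => col i F), (fun i => d 0 i); split.
- have <- : ulsubmx (1%:M : 'M[C]_(m + n)) = 1%:M.
    by rewrite scalar_mx_block block_mxKul.
  rewrite -PP -[P^t* in LHS]mulmx1 ulE -[1%:M]diag_const_mx mul_diag_adj.
  by apply: eq_bigr => i _; rewrite mxE scale1r.
- by rewrite NE ulE mul_diag_adj.
have -> : N^t* *m N = P^t* *m diag_mx (\row_i ((d 0 i)^* * d 0 i)%R) *m P.
  rewrite NE !adjmxM trmxCK -!mulmxA [P *m _]mulmxA (unitarymxP PU) mul1mx.
  rewrite tr_diag_mx map_diag_mx [diag_mx _ *m (diag_mx _ *m _)]mulmxA mulmx_diag.
  by congr (_ *m (diag_mx _ *m _)); apply/rowP => i; rewrite !mxE.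
by rewrite ulE mul_diag_adj; apply: eq_bigr => i _; rewrite mxE.
Qed.

Lemma superpositive_adj k Phi X : superpositive_cone R k Phi ->
  Phi (X^t*) = (Phi X)^t*.
Proof.
move=> [n [A [_ ->]]]; rewrite !sum_lfunE adjmx_sum; apply: eq_bigr => i _.
by rewrite !AdE !adjmxM trmxCK mulmxA.
Qed.

(** This is the form of the Choi matrix at the vector with blocks [u] and [v]; [outer_form_ge0]
    handles each Kraus term. *)
Lemma superpositive_form_ge0 k Phi u v : superpositive_cone R k Phi ->
  0 <= (u^t* *m Phi (delta_mx 0 0) *m u + u^t* *m Phi (delta_mx 0 1) *m v
      + v^t* *m Phi (delta_mx 1 0) *m u + v^t* *m Phi (delta_mx 1 1) *m v) 0 0.
Proof.
move=> [n [A [_ ->]]].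
rewrite !sum_lfunE !mulmx_sumr !mulmx_suml -!big_split summxE.
apply: sumr_ge0 => i _; rewrite !Ad_delta /=.
exact: outer_form_ge0.
Qed.

Lemma Ad_outer_delta (f w : 'cV[C]_2) i j :
  Ad (f *m w^t*) (delta_mx i j) = ((w i 0)^* * w j 0)%R *: (f *m f^t*).
Proof.
rewrite Ad_delta; apply/matrixP => a b.
rewrite !mxE !big_ord1 !mxE !big_ord1 !mxE.
by rewrite rmorphM /= conjCK mulrACA mulrC.
Qed.

Lemma product_decomposition Phi I (r : seq I) (f : I -> 'cV[C]_2) (z : I -> C) :
  Phi (delta_mx 0 0) = \sum_(i <- r) f i *m (f i)^t* ->
  Phi (delta_mx 0 1) = \sum_(i <- r) z i *: (f i *m (f i)^t*) ->
  Phi (delta_mx 1 0) = (Phi (delta_mx 0 1))^t* ->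
  psd (Phi (delta_mx 1 1) -
       \sum_(i <- r) ((z i)^* * z i)%R *: (f i *m (f i)^t*)) ->
  superpositive_cone R 1 Phi.
Proof.
move=> E00 E01 E10 /psd_gram_exists[V E11].
pose w (c d : C) : 'cV[C]_2 := \col_i (if i == 0 then c else d).
have -> : Phi = \sum_(i <- r) Ad (f i *m (w 1 (z i))^t*)
    + \sum_k Ad (col k V *m (w 0 1)^t*).
  have E i j : (\sum_(i <- r) Ad (f i *m (w 1 (z i))^t*)
      + \sum_k Ad (col k V *m (w 0 1)^t*)) (delta_mx i j) =
     \sum_(l <- r) ((w 1 (z l) i 0)^* * w 1 (z l) j 0)%R *: (f l *m (f l)^t*)
     + \sum_k ((w 0 1 i 0)^* * w 0 1 j 0)%R *: (col k V *m (col k V)^t*).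
    rewrite add_lfunE !sum_lfunE; congr (_ + _); apply: eq_bigr => k _;
    exact: Ad_outer_delta.
  apply: superop_ext; apply: ord2_ind; apply: ord2_ind; rewrite E.
  - rewrite E00 [X in _ + X]big1 ?addr0 => [|k _].
      by apply: eq_bigr => l _; rewrite !mxE /= conjC1 mul1r scale1r.
    by rewrite !mxE /= conjC0 mul0r scale0r.
  - rewrite E01 [X in _ + X]big1 ?addr0 => [|k _].
      by apply: eq_bigr => l _; rewrite !mxE /= conjC1 mul1r.
    by rewrite !mxE /= conjC0 mul0r scale0r.
  - rewrite E10 E01 adjmx_sum [X in _ + X]big1 ?addr0 => [|k _].
      apply: eq_bigr => l _; rewrite adjmxZ adjmxM trmxCK.
      by rewrite !mxE /= mulr1.
    by rewrite !mxE /= mulr0 scale0r.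
  rewrite -[LHS](subrK (\sum_(i <- r) ((z i)^* * z i)%R *: (f i *m (f i)^t*))).
  rewrite E11 addrC; congr (_ + _); first by apply: eq_bigr => l _; rewrite !mxE.
  apply/matrixP => a b; rewrite mxE summxE; apply: eq_bigr => k _.
  by rewrite !mxE /= conjC1 mulr1 big_ord1 mul1r !mxE.
by apply: superpositiveD; apply: superpositive_sum => k;
  apply/superpositive_Ad/rank_outer.
Qed.

(* If [Phi E00 = 1], the two positivity conditions say that [D = Phi E11]
   dominates both [B^* B] and [B B^*], where [B = Phi E01]. *)
Lemma ppt_normalized Phi : superpositive_cone R 2 Phi ->
  superpositive_cone R 2 (Phi \o transp R)%VF -> Phi (delta_mx 0 0) = 1%:M ->
  superpositive_cone R 1 Phi.
Proof.
move=> PhiP PhitP E00; set B := Phi (delta_mx 0 1); set D := Phi (delta_mx 1 1).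
have E10 : Phi (delta_mx 1 0) = B^t*.
  by rewrite -(superpositive_adj _ PhiP) adjmx_delta.
(* The block form at [- X *m v] and [v] is the Schur complement. It is used with [X = B] for [Phi],
   and with the adjoint of [B] for [Phi \o transp R]. *)
have schur (X : 'M[C]_2) v : (- X *m v)^t* *m 1%:M *m (- X *m v)
   + (- X *m v)^t* *m X *m v + v^t* *m X^t* *m (- X *m v) + v^t* *m D *m v
   = v^t* *m (D - X^t* *m X) *m v.
  rewrite mulNmx -scaleN1r !adjmxZ conjCN1 !scaleN1r adjmxM mulmx1.
  rewrite !mulNmx !mulmxN opprK !mulmxA mulmxBr mulmxBl !mulmxA.
  rewrite addrC; congr (_ + _).
  by rewrite subrr add0r.
have BD : psd (D - B^t* *m B).
  move=> v; rewrite -schur.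
  by have := superpositive_form_ge0 (- B *m v) v PhiP; rewrite E00 E10.
have BtD : psd (D - B *m B^t*).
  move=> v; rewrite -[X in X *m B^t*](trmxCK B) -schur trmxCK.
  have := superpositive_form_ge0 (- B^t* *m v) v PhitP.
  by rewrite !comp_lfunE !transpE !trmx_delta E00 E10.
have [x [y [z [N_normal Dp]]]] := normal_dilation BtD BD.
have [f [c [f1 fB fD]]] := normal_compression N_normal.
rewrite block_mxKul in fB.
rewrite adjmx_block mulmx_block block_mxKul in fD.
rewrite fD in Dp.
apply: product_decomposition E10 Dp; first by rewrite E00.
exact: fB.
Qed.

(** The form at [u] is the sum of the squared norms of a^* u, with [a] the column 0 of each Kraus
    operator. All of these vanish, and a^* u is a factor of each term of [Phi E_i0 u]. *)
Lemma superpositive_ker k Phi i u : superpositive_cone R k Phi ->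
  (u^t* *m Phi (delta_mx 0 0) *m u) 0 0 = 0 -> Phi (delta_mx i 0) *m u = 0.
Proof.
move=> [n [A [_ ->]]]; rewrite !sum_lfunE.
have formE l : u^t* *m Ad (A l) (delta_mx 0 0) *m u =
    ((col 0 (A l))^t* *m u)^t* *m ((col 0 (A l))^t* *m u).
  by rewrite Ad_delta adjmxM trmxCK !mulmxA.
rewrite mulmx_sumr mulmx_suml summxE => /eqP; rewrite psumr_eq0; last first.
  by move=> l _; rewrite formE dotmx_ge0.
move=> /allP Au; rewrite mulmx_suml big1 // => l _.
have := Au l (mem_index_enum _); rewrite formE dotmx_eq0 => /eqP Alu.
by rewrite Ad_delta -mulmxA Alu mulmx0.
Qed.

Lemma cV2_resolution (a : 'cV[C]_2) : exists u, (a^t* *m u = 0) /\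
  a *m a^t* + u *m u^t* = ((a^t* *m a) 0 0)%:M.
Proof.
(* This vector is orthogonal to [a] and has the same length. *)
exists (\col_i if i == 0 then - (a 1 0)^*%R else (a 0 0)^*%R); split.
  rewrite [LHS]mx11_scalar cV2_dot !mxE /= mulrN mulrC addrC subrr.
  by rewrite raddf0.
apply/matrixP; apply: ord2_ind; apply: ord2_ind;
  rewrite cV2_dot !mxE !big_ord1 !mxE /= ?mulr1n ?mulr0n ?rmorphN /= ?conjCK;
  ring.
Qed.

(** Multiplying [B] on both sides by the resolution a a^* + u u^* of a multiple of the identity
    leaves only the term between the two copies of a a^*. For [a = 0] every vector is in the
    kernel. *)
Lemma scalar_of_kernels B (a : 'cV[C]_2) :
  (forall u, a^t* *m u = 0 -> B *m u = 0) ->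
  (forall u, a^t* *m u = 0 -> B^t* *m u = 0) ->
  exists b : C, B = b *: (a *m a^t*).
Proof.
move=> kerB kerBt; have [a0|a0] := eqVneq a 0.
  exists 0; rewrite scale0r; apply/matrixP => i j; rewrite mxE.
  have /colP/(_ i) : B *m delta_mx j 0 = 0 :> 'cV_2.
    by apply: kerB; rewrite a0 trmx0 map_mx0 mul0mx.
  by rewrite -colE !mxE.
have [u [au ruE]] := cV2_resolution a; set r := (a^t* *m a) 0 0 in ruE.
have r0 : r != 0 by rewrite /r dotmx_eq0.
have uB : u^t* *m B = 0 by rewrite -[B]trmxCK -adjmxM kerBt // trmx0 map_mx0.
exists ((a^t* *m B *m a) 0 0 / (r * r)).
have rB : (r * r) *: B = (a^t* *m B *m a) 0 0 *: (a *m a^t*).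
  transitivity ((a *m a^t* + u *m u^t*) *m B *m (a *m a^t* + u *m u^t*)).
    by rewrite ruE mul_scalar_mx mul_mx_scalar scalerA.
  rewrite mulmxDl -(mulmxA u) uB mulmx0 addr0 mulmxDr.
  rewrite [X in _ + X]mulmxA -(mulmxA _ B u) kerB // mulmx0 mul0mx addr0.
  transitivity (a *m (a^t* *m B *m a) *m a^t*); first by rewrite !mulmxA.
  by rewrite {1}[a^t* *m B *m a]mx11_scalar mul_mx_scalar -scalemxAl.
by rewrite mulrC -scalerA -rB scalerA mulVf ?scale1r // mulf_neq0.
Qed.

(* If [Phi E00 = a a^*], the kernel conditions force [Phi E01] to be a multiple of
   [a a^*]; this includes the case [a = 0]. *)
Lemma ppt_singular Phi (a : 'cV[C]_2) : superpositive_cone R 2 Phi ->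
  superpositive_cone R 2 (Phi \o transp R)%VF -> Phi (delta_mx 0 0) = a *m a^t* ->
  superpositive_cone R 1 Phi.
Proof.
move=> PhiP PhitP E00; set B := Phi (delta_mx 0 1); set D := Phi (delta_mx 1 1).
have E10 : Phi (delta_mx 1 0) = B^t*.
  by rewrite -(superpositive_adj _ PhiP) adjmx_delta.
have ker00 u : a^t* *m u = 0 -> (u^t* *m Phi (delta_mx 0 0) *m u) 0 0 = 0.
  by move=> au; rewrite E00 !mulmxA -mulmxA au mulmx0 mxE.
have [b BE] : exists b : C, B = b *: (a *m a^t*).
  (* The transposed map sends E10 to [B], and [Phi] itself sends E10 to the adjoint of [B]; each
     gives one kernel condition. *)
  apply: scalar_of_kernels => u au.
    have := superpositive_ker 1 PhitP (_ : (u^t* *m _ *m u) 0 0 = 0).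
    rewrite !comp_lfunE !transpE !trmx_delta; apply; exact: ker00.
  by have := superpositive_ker 1 PhiP (ker00 u au); rewrite E10.
apply: (@product_decomposition _ _ [:: tt] (fun=> a) (fun=> b)).
- by rewrite big_seq1.
- by rewrite big_seq1.
- exact: E10.
rewrite big_seq1 => v; have := superpositive_form_ge0 (- b *: v) v PhiP.
by rewrite E00 E10 -/B -/D BE schur_form // adjmxM trmxCK.
Qed.

(** An invertible [Phi E00] = W W^* is normalised to 1 by composing on the left with [Ad (invmx W)].
    This commutes with composing on the right with the transposition, so both hypotheses persist,
    and [Ad W] brings the conclusion back. *)
Lemma peres_horodecki Phi : superpositive_cone R 2 Phi ->
  superpositive_cone R 2 (Phi \o transp R)%VF -> superpositive_cone R 1 Phi.
Proof.
move=> PhiP PhitP; set A := Phi (delta_mx 0 0).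
have Ap : psd A.
  move=> v; have := superpositive_form_ge0 v 0 PhiP.
  by rewrite trmx0 map_mx0 !mulmx0 !mul0mx !addr0.
have [dA|dA] := eqVneq (\det A) 0.
  have [a aE] := psd2_rank1 Ap dA.
  exact: ppt_singular PhiP PhitP aE.
have [W WE] := psd_gram_exists Ap.
have WU : W \in unitmx.
  rewrite unitmxE unitfE; apply: contra_neq dA => dW.
  by rewrite WE det_mulmx dW mul0r.
pose Psi := (Ad (invmx W) \o Phi)%VF.
have PhiE : Phi = (Ad W \o Psi)%VF.
  by rewrite comp_lfunA Ad_comp mulmxV // Ad1 comp_lfun1l.
have AdP V : superpositive_cone R 2 (Ad V).
  by apply: superpositive_Ad; rewrite rank_leq_row.
rewrite PhiE; apply: (superpositive_comp (l := 1) (AdP W)).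
apply: ppt_normalized.
- exact: (superpositive_comp (AdP _) PhiP).
- by rewrite -comp_lfunA; apply: (superpositive_comp (AdP _) PhitP).
by rewrite comp_lfunE AdE -/A WE mulmxA mulVmx // mul1mx -adjmxM mulVmx // adjmx1.
Qed.
End PPT.

(** * Extremality of the identity map *)

Section Extremality.
Local Open Scope sesquilinear_scope.

(** The hypothesis is one row of the statement that a map sends w w^* to a matrix killing the
    orthogonal complement of w = (s, t). The points (1, 0), (0, 1), (1, 1), (1, -1), (1, i) and (1,
    -i) suffice to isolate the coefficients. *)
Lemma annihilation_system (C : numClosedFieldType)
    (p00 p01 p10 p11 q00 q01 q10 q11 : C) :
  (forall s t : C,
    (s * s^* * p00 + s * t^* * p01 + t * s^* * p10 + t * t^* * p11) * - t^* +
    (s * s^* * q00 + s * t^* * q01 + t * s^* * q10 + t * t^* * q11) * s^* = 0) ->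
  [/\ q00 = 0, p11 = 0, p01 = 0 & [/\ q10 = 0, q01 = p00 & q11 = p10]].
Proof.
move=> H.
have q00E : q00 = 0 by rewrite -[RHS](H 1 0) conjC1 conjC0; ring.
have p11E : p11 = 0.
  by apply/oppr_inj; rewrite oppr0 -[RHS](H 0 1) conjC1 conjC0; ring.
have H1 := H 1 1; have H2 := H 1 (-1); have H3 := H 1 'i; have H4 := H 1 (- 'i).
rewrite ?(rmorphN, conjC1, conjCi, opprK) /= ?conjCi in H1 H2 H3 H4.
have i2 : 'i * 'i = -1 :> C by rewrite -expr2 sqrCi.
have two0 : (2 : C) != 0 by rewrite pnatr_eq0.
have sum12 : q11 = p01 + p10.
  apply: (mulfI two0); apply/eqP; rewrite -subr_eq0; apply/eqP.
  rewrite -[RHS]addr0 -{1}H1 -H2 q00E p11E; ring.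
have sum34 : q11 = p10 - p01.
  apply: (mulfI two0); apply/eqP; rewrite -subr_eq0; apply/eqP.
  rewrite -[RHS]addr0 -{1}H3 -H4 q00E p11E; ring: i2.
have dif12 : q01 + q10 = p00.
  apply: (mulfI two0); apply/eqP; rewrite -subr_eq0; apply/eqP.
  rewrite -[RHS]subr0 -{1}H1 -H2 q00E p11E; ring.
have dif34 : q01 - q10 = p00.
  apply: (mulfI (neq0Ci C)); apply: (mulfI two0).
  apply/eqP; rewrite -subr_eq0; apply/eqP.
  rewrite -[RHS]subr0 -{1}H4 -H3 q00E p11E; ring: i2.
have p01E : p01 = 0.
  apply: (mulfI two0); rewrite mulr0 -[RHS](subrr q11) {1}sum12 sum34; ring.
have q10E : q10 = 0.
  apply: (mulfI two0); rewrite mulr0 -[RHS](subrr p00) -{1}dif12 -dif34; ring.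
by rewrite p01E add0r in sum12; rewrite q10E addr0 in dif12.
Qed.

Context {R : realType}.
Local Notation C := R[i].
Implicit Types (Phi Psi : superop R).

Lemma id_extremal Phi Psi c : positive_map Phi -> positive_map Psi ->
  Phi + Psi = c *: \1%VF -> exists2 a : C, 0 <= a & Phi = a *: \1%VF.
Proof.
move=> Phip Psip E.
have annih (x y : 'cV[C]_2) : x^t* *m y = 0 -> Phi (x *m x^t*) *m y = 0.
  move=> xy; have xp := psd_gram x; apply: (psd_ker (Phip _ xp)).
  apply/le_anti; rewrite (Phip _ xp) andbT.
  have <- : (y^t* *m (Phi (x *m x^t*) + Psi (x *m x^t*)) *m y) 0 0 = 0.
    rewrite -add_lfunE E scale_lfunE id_lfunE -scalemxAr -scalemxAl.
    by rewrite -!mulmxA xy !mulmx0 scaler0 mxE.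
  by rewrite mulmxDr mulmxDl addmx11 lerDl; exact: Psip.
pose w (s t : C) : 'cV[C]_2 := \col_k if k == 0 then s else t.
pose F i j := Phi (delta_mx i j).
have outerE s t : w s t *m (w s t)^t* =
     (s * s^*)%R *: delta_mx 0 0 + (s * t^*)%R *: delta_mx 0 1
     + (t * s^*)%R *: delta_mx 1 0 + (t * t^*)%R *: delta_mx 1 1.
  apply/matrixP; apply: ord2_ind; apply: ord2_ind; rewrite !mxE big_ord1 !mxE /=;
    ring.
have cols i : [/\ F 0 0 i 1 = 0, F 1 1 i 0 = 0, F 0 1 i 0 = 0 &
    [/\ F 1 0 i 1 = 0, F 0 1 i 1 = F 0 0 i 0 & F 1 1 i 1 = F 1 0 i 0]].
  apply: annihilation_system => s t.
  have : Phi (w s t *m (w s t)^t*) *m w (- t^*%R) (s^*%R) = 0.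
    apply: annih; rewrite [LHS]mx11_scalar cV2_dot !mxE /=.
    by rewrite mulrN mulrC addrC subrr raddf0.
  rewrite outerE !linearD !linearZ /= -/(F 0 0) -/(F 0 1) -/(F 1 0) -/(F 1 1).
  move/colP/(_ i); rewrite mxE !big_ord_recl big_ord0 !mxE addr0 /=.
  by rewrite (_ : lift ord0 ord0 = 1) //; apply/val_inj.
(* By [cols], [Phi] is left multiplication by a fixed matrix. Hermiticity of its values at E00, at
   E11 and at the all-ones matrix makes that matrix scalar. *)
have herm X : psd X -> Phi X 1 0 = (Phi X 0 1)^*%R.
  by move=> /Phip/psd_adj/hermitian2E.
have [F00_01 F11_00 F01_00 [F10_01 F01_01 F11_01]] := cols 0.
have [F00_11 F11_10 F01_10 [F10_11 F01_11 F11_11]] := cols 1.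
have F00_10 : F 0 0 1 0 = 0 by rewrite herm ?F00_01 ?conjC0 //; exact: delta_psd.
have F11_01' : F 1 1 0 1 = 0.
  by apply/eqP; rewrite -conjC_eq0 -herm ?F11_10 //; exact: delta_psd.
exists (F 0 0 0 0); first exact/psd_diag/Phip/delta_psd.
have F10_10 : F 1 0 1 0 = F 0 0 0 0.
  have := herm _ (psd_gram (w 1 1)); rewrite outerE conjC1 mulr1 !scale1r.
  rewrite !linearD /= -/(F 0 0) -/(F 0 1) -/(F 1 0) -/(F 1 1).
  rewrite ![fun_of_matrix (_ + _) _ _]mxE.
  rewrite F00_10 F01_10 F11_10 F00_01 F10_01 F11_01' F01_01 !addr0 !add0r => ->.
  by rewrite conj_Creal // ger0_real //; exact/psd_diag/Phip/delta_psd.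
apply: superop_ext => i j; rewrite scale_lfunE id_lfunE -/(F i j).
apply/matrixP => k l; rewrite !mxE.
by elim/ord2_ind: i; elim/ord2_ind: j; elim/ord2_ind: k; elim/ord2_ind: l;
  rewrite ?(F00_01, F00_10, F00_11, F01_00, F01_10, F01_01, F01_11, F10_01,
    F10_11, F10_10, F11_00, F11_10, F11_01', F11_11) -?F11_01 ?F11_01'
    /= ?mulr0 ?mulr1.
Qed.

Lemma id_extremal_sum (I : finType) (F : I -> superop R) c :
  (forall i, positive_map (F i)) -> \sum_i F i = c *: \1%VF ->
  forall i, exists2 a : C, 0 <= a & F i = a *: \1%VF.
Proof.
move=> Fp E i; move: E; rewrite (bigD1 i) //=; apply: id_extremal => //.
move=> X Xp; rewrite sum_lfunE; apply: psd_sum => j; exact: Fp.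
Qed.

Lemma positive_Ad (A : 'M[C]_2) : positive_map (Ad A).
Proof. by move=> X Xp; rewrite AdE; exact: psd_congr. Qed.

Lemma superpositive_positive k Phi :
  superpositive_cone R k Phi -> positive_map Phi.
Proof.
move=> [n [A [_ ->]]] X Xp; rewrite sum_lfunE; apply: psd_sum => i.
exact: positive_Ad.
Qed.

Lemma positive_comp Phi Psi : positive_map Phi -> positive_map Psi ->
  positive_map (Phi \o Psi)%VF.
Proof. by move=> Phip Psip X /Psip/Phip; rewrite comp_lfunE. Qed.

Lemma Ad_scale c (A : 'M[C]_2) : 0 <= c -> c *: Ad A = Ad (sqrtC c *: A).
Proof.
move=> c0; apply/lfunP => X; rewrite scale_lfunE !AdE adjmxZ.
rewrite conj_Creal ?ger0_real ?sqrtC_ge0 // -!scalemxAl -scalemxAr scalerA.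
by rewrite -expr2 sqrtCK.
Qed.

(** The determinant of the value at 1 shows that [A] is invertible. If [B] were singular, the outer
    product of a kernel vector would be sent to 0 instead of a nonzero multiple of itself. Then
    [Phi] is obtained by inverting both sides. *)
Lemma Ad_sandwich_id Phi (A B : 'M[C]_2) c : 0 <= c -> c != 0 ->
  (Ad A \o Phi \o Ad B)%VF = c *: \1%VF -> exists M, Phi = Ad M.
Proof.
move=> c_ge0 c0 E.
have EX X : A *m Phi (B *m X *m B^t*) *m A^t* = c *: X.
  by have /lfunP/(_ X) := E; rewrite !comp_lfunE !AdE scale_lfunE id_lfunE.
have AU : A \in unitmx.
  rewrite unitmxE unitfE; apply/eqP => dA; have := congr1 determinant (EX 1%:M).
  rewrite !det_mulmx dA !mul0r detZ det1 mulr1 => /esym/eqP.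
  by rewrite expf_eq0 (negPf c0).
have BU : B \in unitmx.
  rewrite unitmxE unitfE; apply/eqP => dB.
  have /eqP/det0P[v v0 vB] : \det (B^t*) = 0.
    by rewrite det_map_mx det_tr dB rmorph0.
  have := EX (v^t* *m v); rewrite -!mulmxA vB !mulmx0 linear0 mul0mx mulmx0.
  move=> /esym/eqP; rewrite scaler_eq0 (negPf c0) => /eqP vv.
  have := dotmx_eq0 (v^t*).
  rewrite -trace_mx11 mxtrace_mulC trmxCK vv mxtrace0 eqxx.
  move=> /esym/eqP v'0; move/eqP: v0; apply.
  by rewrite -[v]trmxCK v'0 trmx0 map_mx0.
exists (sqrtC c *: (invmx A *m invmx B)); rewrite -Ad_scale // -Ad_comp.
have <- : (Ad (invmx A) \o (Ad A \o Phi \o Ad B) \o Ad (invmx B))%VF = Phi.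
  rewrite !comp_lfunA Ad_comp mulVmx // Ad1 comp_lfun1l -comp_lfunA.
  by rewrite Ad_comp mulmxV // Ad1 comp_lfun1r.
rewrite E; apply/lfunP => X.
by rewrite !comp_lfunE !scale_lfunE !comp_lfunE id_lfunE linearZ.
Qed.

Lemma sum_neq0_exists (V : zmodType) (I : finType) (F : I -> V) :
  \sum_i F i != 0 -> exists i, F i != 0.
Proof.
move=> F0; have [i Fi|Fz] := pickP (fun i => F i != 0); first by exists i.
by move: F0; rewrite big1 ?eqxx // => i _; apply/eqP/negbFE/Fz.
Qed.

Lemma id_lfun_neq0 : (\1%VF : superop R) != 0.
Proof.
apply/eqP => /lfunP/(_ 1%:M)/matrixP/(_ 0 0); rewrite id_lfunE zero_lfunE !mxE /=.
by apply/eqP; rewrite oner_eq0.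
Qed.

(** Extremality is applied twice: first to a nonzero summand of the decomposition of the identity,
    then, after expanding its outer factors into Kraus operators, to a single term
    [Ad A \o Phi \o Ad B]. *)
Lemma id_in_mapping_cone Phi : positive_map Phi ->
  mapping_cone [set Phi] \1%VF -> exists A, Phi = Ad A.
Proof.
move=> Phip [n [F [Omega [G [FOG E]]]]].
have [i Hi] : exists i, (F i \o Omega i \o G i)%VF != 0.
  by apply: sum_neq0_exists; rewrite -E id_lfun_neq0.
have Hp j : positive_map (F j \o Omega j \o G j)%VF.
  have [-> ] := FOG j; rewrite cp_coneE => /superpositive_positive Fp.
  move=> /superpositive_positive Gp.
  exact: positive_comp (positive_comp Fp Phip) Gp.
have [a a0 Ha] := id_extremal_sum Hp (etrans (esym E) (esym (scale1r _))) i.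
have {Hi} a_neq0 : a != 0.
  by apply: contra_neq Hi => a_eq0; rewrite Ha a_eq0 scale0r.
move: Ha; have [-> ] := FOG i; rewrite cp_coneE => -[m [A [_ ->]]] [p [B [_ ->]]].
rewrite comp_lfun_suml comp_lfun_sumr.
under eq_bigr do rewrite comp_lfun_suml.
rewrite pair_big /= => Ha.
pose K (kj : 'I_p * 'I_m) := (Ad (A kj.2) \o Phi \o Ad (B kj.1))%VF.
have [kj Hkj] : exists kj, K kj != 0.
  by apply: sum_neq0_exists; rewrite Ha scaler_eq0 negb_or a_neq0 id_lfun_neq0.
have Kp kj' : positive_map (K kj').
  exact: positive_comp (positive_comp (@positive_Ad _) Phip) (@positive_Ad _).
have [b b0 Hb] := id_extremal_sum Kp Ha kj.
apply: (Ad_sandwich_id b0 _ Hb).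
by apply: contra_neq Hkj => b_eq0; rewrite Hb b_eq0 scale0r.
Qed.
End Extremality.

(** * Mapping cones *)

Section MappingCones.
Local Open Scope sesquilinear_scope.
Context {R : realType}.
Local Notation C := R[i].
Local Notation t := (transp R).
Implicit Types (Phi Psi Theta : superop R) (M : set (superop R)).

Lemma cp_Ad (A : 'M[C]_2) : cp_cone R (Ad A).
Proof. by rewrite cp_coneE; apply: superpositive_Ad; rewrite rank_leq_row. Qed.

Lemma cp_id : cp_cone R \1%VF.
Proof. by rewrite -Ad1; exact: cp_Ad. Qed.

Lemma cp_positive Phi : cp_cone R Phi -> positive_map Phi.
Proof. by rewrite cp_coneE; exact: superpositive_positive. Qed.

Lemma comp_transpK Phi : (Phi \o t \o t)%VF = Phi.
Proof. by rewrite -comp_lfunA transpK comp_lfun1r. Qed.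

Lemma cone_transpE M Phi : cone_transp M Phi <-> M (Phi \o t)%VF.
Proof.
split=> [[Psi MPsi <-]|MPhi]; first by rewrite comp_transpK.
by exists (Phi \o t)%VF; rewrite ?comp_transpK.
Qed.

Lemma mapping_cone_self Phi : mapping_cone [set Phi] Phi.
Proof.
exists 1%N, (fun=> \1%VF), (fun=> Phi), (fun=> \1%VF); split=> [i|].
  by split=> //; exact: cp_id.
by rewrite big_ord1 comp_lfun1l comp_lfun1r.
Qed.

Lemma mapping_cone_sub k Phi : (k <= 2)%N -> superpositive_cone R k Phi ->
  mapping_cone [set Phi] `<=` superpositive_cone R k.
Proof.
move=> k2 PhiS _ [n [F [Omega [G [FOG ->]]]]]; apply: superpositive_sum => i.
have [-> ] := FOG i; rewrite cp_coneE => Fp Gp.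
have := superpositive_comp (superpositive_comp Fp PhiS) Gp.
by rewrite (minn_idPr k2) (minn_idPl k2).
Qed.

Lemma cp_diag_entry_gt0 k Phi : superpositive_cone R k Phi -> Phi <> 0 ->
  exists a b, 0 < Phi (delta_mx b b) a a.
Proof.
move=> [n [A [_ PhiE]]] /eqP; rewrite PhiE => /sum_neq0_exists[i Ai].
have [[a b] /= Aab|A0] := pickP (fun ab : 'I_2 * 'I_2 => A i ab.1 ab.2 != 0);
  last first.
  move: Ai; have -> : A i = 0; last by rewrite Ad0 eqxx.
  by apply/matrixP => a b; rewrite mxE; have /= := A0 (a, b); move/negbFE/eqP.
exists a, b; rewrite sum_lfunE summxE.
have entryE l : Ad (A l) (delta_mx b b) a a = A l a b * (A l a b)^*%R.
  by rewrite Ad_delta mxE big_ord1 !mxE.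
rewrite (bigD1 i) //= ltr_pwDl ?entryE ?mul_conjC_gt0 // sumr_ge0 // => l _.
by rewrite entryE mul_conjC_ge0.
Qed.

(** Between two maps of rank one, only one number of [Phi] survives. This produces every map of rank
    one, up to a factor, from [Phi]. *)
Lemma Ad_outer_sandwich Phi (x y u v : 'cV[C]_2) :
  (Ad (x *m u^t*) \o Phi \o Ad (v *m y^t*))%VF =
  (u^t* *m Phi (v *m v^t*) *m u) 0 0 *: Ad (x *m y^t*).
Proof.
apply/lfunP => X; rewrite comp_lfunE comp_lfunE scale_lfunE.
rewrite [LHS]AdE [in RHS]AdE [in LHS]AdE !adjmxM !trmxCK.
have -> : v *m y^t* *m X *m (y *m v^t*) = (y^t* *m X *m y) 0 0 *: (v *m v^t*).
  transitivity (v *m (y^t* *m X *m y) *m v^t*); first by rewrite !mulmxA.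
  by rewrite {1}[y^t* *m X *m y]mx11_scalar mul_mx_scalar -scalemxAl.
rewrite linearZ; set P := Phi _.
transitivity ((y^t* *m X *m y) 0 0 *: (x *m (u^t* *m P *m u) *m x^t*)).
  by rewrite -scalemxAr -scalemxAl !mulmxA.
transitivity ((u^t* *m P *m u) 0 0 *: (x *m (y^t* *m X *m y) *m x^t*));
  last by rewrite !mulmxA.
rewrite {1}[u^t* *m P *m u]mx11_scalar {2}[y^t* *m X *m y]mx11_scalar.
by rewrite !mul_mx_scalar -!scalemxAl !scalerA mulrC.
Qed.

(** A nonzero [Phi] has a positive diagonal entry [c] at some diagonal matrix unit. Sandwiching with
    the corresponding basis vectors yields [c] times any given map of rank one, and the factor is
    divided out in the left map. *)
Lemma superpositive1_mapping_cone k Phi :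
  superpositive_cone R k Phi -> Phi <> 0 ->
  superpositive_cone R 1 `<=` mapping_cone [set Phi].
Proof.
move=> PhiS Phi0 _ [n [A [rA ->]]].
have [a [b c0]] := cp_diag_entry_gt0 PhiS Phi0; set c := Phi _ a a in c0.
have /choice[xy Axy] i : exists xy : 'cV[C]_2 * 'cV[C]_2, A i = xy.1 *m xy.2^t*.
  by have [x [y ->]] := rank1_outer (rA i); exists (x, y).
exists n, (fun i => c^-1 *: Ad ((xy i).1 *m (delta_mx a 0)^t*)), (fun=> Phi),
  (fun i => Ad (delta_mx b 0 *m (xy i).2^t*)); split=> [i|].
  by split=> //; rewrite ?Ad_scale ?invr_ge0 ?ltW //; exact: cp_Ad.
apply: eq_bigr => i _; rewrite -!comp_lfunZl Ad_outer_sandwich scalerA.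
have -> : ((delta_mx a 0 : 'cV_2)^t* *m
    Phi (delta_mx b 0 *m (delta_mx b 0 : 'cV_2)^t*) *m
    (delta_mx a 0 : 'cV_2)) 0 0 = c.
  by rewrite !adjmx_delta mul_delta_mx -rowE -colE !mxE.
by rewrite mulVf ?gt_eqF // scale1r Axy.
Qed.

(** Inserting [t \o t] after [Phi] moves the transposition next to it; the right factor becomes
    [t \o G i \o t], which is again completely positive. *)
Lemma mapping_cone_transp Phi Theta : mapping_cone [set Phi] Theta ->
  mapping_cone [set (Phi \o t)%VF] (Theta \o t)%VF.
Proof.
move=> [n [F [Omega [G [FOG ->]]]]].
exists n, F, (fun=> (Phi \o t)%VF), (fun i => (t \o G i \o t)%VF); split=> [i|].
  have [_ Fp Gp] := FOG i; split; [by []|exact: Fp|].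
  by move: Gp; rewrite cp_coneE; exact: superpositive_conj_transp.
rewrite comp_lfun_suml; apply: eq_bigr => i _; have [-> _ _] := FOG i.
by rewrite !comp_lfunA comp_transpK.
Qed.

Lemma cone_transp_mapping_cone Phi :
  cone_transp (mapping_cone [set Phi]) = mapping_cone [set (Phi \o t)%VF].
Proof.
apply/seteqP; split=> Theta.
  by move=> [Psi MPsi <-]; exact: mapping_cone_transp.
by move=> /mapping_cone_transp; rewrite comp_transpK cone_transpE.
Qed.

(** * Typical cones *)

Lemma psd_trmx n (X : 'M[C]_n) : psd X -> psd X^T.
Proof.
move=> Xp v; have := Xp (map_mx Num.conj v).
have <- : ((map_mx Num.conj v)^t* *m X *m map_mx Num.conj v)^T = v^t* *m X^T *m v.
  rewrite !trmx_mul mulmxA.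
  by congr (_ *m _ *m _); apply/matrixP => i j; rewrite !mxE ?conjCK.
by rewrite [X in _ -> 0 <= X]mxE.
Qed.

Lemma positive_1_positive Phi : positive_map Phi -> k_positive 1 Phi.
Proof.
(* ['I_(1 * 2)] and ['I_2] are convertible, hence so are the matrix types. *)
move=> Phip X Xp.
have idx (i : 'I_1) (a : 'I_2) : mxtens_index (i, a) = a :> 'I_2.
  by apply/val_inj; rewrite /= (ord1 i) mul0n.
have blockE : mxtens_block X 0 0 = X :> 'M_2.
  by apply/matrixP => a b; rewrite mxE !idx.
have -> : id_tens Phi X = Phi (X : 'M_2) :> 'M_2.
  by apply/matrixP => a b; rewrite -[in RHS]blockE -id_tens_block mxE !idx.
exact: Phip.
Qed.

(* The two disjunctions are exchanged by the transposition and survive meets and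
   joins; a join keeps the positive alternatives because both cones contain 0. *)
Lemma typical_dichotomy M : typical M ->
  [/\ M 0, M `<=` cp_cone R \/ M t & M `<=` cone_transp (cp_cone R) \/ M \1%VF].
Proof.
have sp1 : superpositive_cone R 1 `<=` cp_cone R.
  by rewrite cp_coneE; exact: superpositive_subset.
have spT : superpositive_cone R 1 `<=` cone_transp (cp_cone R).
  by move=> Phi PhiS; apply/cone_transpE/sp1/superpositive1_transp.
elim=> {M} [k|k|M _ [M0 Mcp Mct]|M1 M2 _ [M01 Mcp1 Mct1] _ [M02 Mcp2 Mct2]
  |M1 M2 _ [M01 Mcp1 Mct1] _ [M02 Mcp2 Mct2]].
(* Among the base cones, P_1 contains both [t] and the identity, P_2 and SP_2 equal CP, and SP_1
   lies in both CP and CP o t. *)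
- case: k => [|[|[|//]]] // _.
    split; first exact: (superpositive_k_positive (superpositive0 1)).
      right; apply: positive_1_positive => X Xp.
      by rewrite transpE; exact: psd_trmx.
    by right; apply: positive_1_positive => X; rewrite id_lfunE.
  rewrite k_positive2E -cp_coneE; split.
  - by rewrite cp_coneE; exact: superpositive0.
  - by left.
  by right; exact: cp_id.
- case: k => [|[|[|//]]] // _.
    by split; [exact: superpositive0|left|left].
  rewrite -cp_coneE; split.
  - by rewrite cp_coneE; exact: superpositive0.
  - by left.
  by right; exact: cp_id.
- split; first by apply/cone_transpE; rewrite comp_lfun0l.
    case: Mct => [Mct|M1]; [left|right].
      by move=> _ [Phi /Mct/cone_transpE ? <-].
    by apply/cone_transpE; rewrite transpK.
  case: Mcp => [Mcp|Mt]; [left|right].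
    by move=> _ [Phi /Mcp ? <-]; apply/cone_transpE; rewrite comp_transpK.
  by apply/cone_transpE; rewrite comp_lfun1l.
- split=> //.
    case: Mcp1 Mcp2 => [S1 _|T1 [S2|T2]]; [left|left|by right].
      by move=> Phi [/S1].
    by move=> Phi [_ /S2].
  case: Mct1 Mct2 => [S1 _|T1 [S2|T2]]; [left|left|by right].
    by move=> Phi [/S1].
  by move=> Phi [_ /S2].
split.
- by exists 0 => //; exists 0 => //; rewrite addr0.
- case: Mcp1 Mcp2 => [S1 [S2|T2]|T1 _]; [left|right|right].
  + move=> _ [Phi /S1 Phip [Psi /S2 Psip <-]]; rewrite cp_coneE in Phip Psip *.
    exact: superpositiveD.
  + by exists 0 => //; exists t => //; rewrite add0r.
  + by exists t => //; exists 0 => //; rewrite addr0.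
case: Mct1 Mct2 => [S1 [S2|T2]|T1 _]; [left|right|right].
- move=> _ [Phi /S1/cone_transpE Phip [Psi /S2/cone_transpE Psip <-]].
  apply/cone_transpE; rewrite comp_lfunDl; rewrite cp_coneE in Phip Psip *.
  exact: superpositiveD.
- by exists 0 => //; exists \1%VF => //; rewrite add0r.
by exists \1%VF => //; exists 0 => //; rewrite addr0.
Qed.

Lemma mapping_cone_untypical Phi : positive_map Phi ->
  ~ cone_transp (cp_cone R) Phi -> (forall A, Phi <> Ad A) ->
  untypical (mapping_cone [set Phi]).
Proof.
move=> Phip nct nAd /typical_dichotomy[_ _ [sub|id_in]].
  exact/nct/sub/mapping_cone_self.
by have [A] := id_in_mapping_cone Phip id_in; exact: nAd.
Qed.

(** * Mapping cones of completely positive maps *)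

Lemma rank_choi_Ad (A : 'M[C]_2) : (\rank (choi (Ad A)) <= 1)%N.
Proof.
pose w : 'cV[C]_(2 * 2) := \col_p A (mxtens_unindex p).2 (mxtens_unindex p).1.
have wA : unvec w = A by apply/matrixP => a i; rewrite !mxE mxtens_indexK.
have -> : choi (Ad A) = \sum_(k <- [:: tt]) w *m w^t*.
  by apply/choi_eq_gram; rewrite big_seq1 wA.
by rewrite big_seq1 rank_outer.
Qed.

Lemma rank1_choi_Ad Phi : cp_cone R Phi -> \rank (choi Phi) = 1%N ->
  exists A, Phi = Ad A.
Proof.
move=> /(_ 2)/choi_psd choip r1.
have [w wE] : exists w : 'cV[C]_(2 * 2), choi Phi = w *m w^t*.
  by apply: psd_rank1; rewrite ?r1.
exists (unvec w).
have : choi Phi = \sum_(k <- [:: tt]) w *m w^t* by rewrite big_seq1.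
by move/choi_eq_gram; rewrite big_seq1.
Qed.

Lemma mapping_cone_superpositive1 Phi : Phi <> 0 -> superpositive_cone R 1 Phi ->
  mapping_cone [set Phi] = superpositive_cone R 1.
Proof.
move=> Phi0 PhiS; apply/seteqP; split; first exact: mapping_cone_sub.
exact: superpositive1_mapping_cone PhiS Phi0.
Qed.

(** Here [Phi = Ad A], and [A] is invertible since otherwise [Phi] would be in SP_1. Any completely
    positive [Theta] is then [Theta \o Phi \o Ad (invmx A)]. *)
Lemma mapping_cone_cp_rank1 Phi : (cp_cone R `\` superpositive_cone R 1) Phi ->
  \rank (choi Phi) = 1%N -> mapping_cone [set Phi] = cp_cone R.
Proof.
move=> [Phicp nPhi1] r1; apply/seteqP; split.
  by move: Phicp; rewrite cp_coneE; exact: mapping_cone_sub.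
have [A PhiE] := rank1_choi_Ad Phicp r1.
have AU : A \in unitmx.
  rewrite -row_free_unit /row_free eqn_leq rank_leq_row ltnNge.
  by apply/negP => rA; apply: nPhi1; rewrite PhiE; exact: superpositive_Ad.
move=> Theta Thetap.
exists 1%N, (fun=> Theta), (fun=> Phi), (fun=> Ad (invmx A)); split=> [i|].
  by split; [|exact: Thetap|exact: cp_Ad].
by rewrite big_ord1 -comp_lfunA PhiE Ad_comp mulmxV // Ad1 comp_lfun1r.
Qed.

(** Membership in CP o t would put [Phi] in SP_1 by [peres_horodecki], and the rank of the Choi
    matrix excludes the form [Ad A]. *)
Lemma mapping_cone_cp_rank2 Phi : (cp_cone R `\` superpositive_cone R 1) Phi ->
  (2 <= \rank (choi Phi))%N -> untypical (mapping_cone [set Phi]).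
Proof.
move=> [Phicp nPhi1] r2; apply: mapping_cone_untypical.
- exact: cp_positive.
- move=> /cone_transpE; rewrite cp_coneE in Phicp *.
  by move/(peres_horodecki Phicp).
by move=> A PhiE; move: r2; rewrite PhiE ltnNge rank_choi_Ad.
Qed.

Lemma cp_transp_setD Phi :
  (cone_transp (cp_cone R) `\` superpositive_cone R 1) Phi ->
  (cp_cone R `\` superpositive_cone R 1) (Phi \o t)%VF.
Proof.
move=> [/cone_transpE PhitP nPhi]; split=> //.
by move/superpositive1_transp; rewrite comp_transpK.
Qed.
End MappingCones.

Unset Implicit Arguments.
Set Strict Implicit.

Theorem theorem18 (R : realType) (Phi : superop R)
    (Phi_neq0 : Phi <> 0) (Phi_pos : positive_map Phi) :
  [/\ (superpositive_cone R 1 Phi ->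
         mapping_cone [set Phi] = superpositive_cone R 1),
      ((cp_cone R `\` superpositive_cone R 1) Phi -> \rank (choi Phi) = 1%N ->
         mapping_cone [set Phi] = cp_cone R),
      ((cp_cone R `\` superpositive_cone R 1) Phi ->
         (2 <= \rank (choi Phi))%N ->
         untypical (mapping_cone [set Phi])) &
      [/\ ((cone_transp (cp_cone R) `\` superpositive_cone R 1) Phi ->
             \rank (choi (Phi \o transp R)%VF) = 1%N ->
             mapping_cone [set Phi] = cone_transp (cp_cone R)),
          ((cone_transp (cp_cone R) `\` superpositive_cone R 1) Phi ->
             (2 <= \rank (choi (Phi \o transp R)%VF))%N ->
             untypical (mapping_cone [set Phi])) &
          (~ (cp_cone R `|` cone_transp (cp_cone R)) Phi ->
             untypical (mapping_cone [set Phi]))]].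
Proof.
(* Cases (d) and (e) are cases (b) and (c) for [Phi \o transp R], carried back by the
   transposition. *)
have coneE : mapping_cone [set Phi] =
    cone_transp (mapping_cone [set (Phi \o transp R)%VF]).
  by rewrite cone_transp_mapping_cone comp_transpK.
split.
- exact: mapping_cone_superpositive1.
- exact: mapping_cone_cp_rank1.
- exact: mapping_cone_cp_rank2.
split.
- by move=> /cp_transp_setD PhiD r1; rewrite coneE mapping_cone_cp_rank1.
(* Typicality survives composition with the transposition, so it would pass from the mapping cone of
   [Phi] to that of [Phi \o transp R]. *)
- move=> /cp_transp_setD PhiD r2 typM; apply: (mapping_cone_cp_rank2 PhiD r2).
  by rewrite -cone_transp_mapping_cone; exact: typical_transp.
move=> nPhi; apply: mapping_cone_untypical => // [Phit|A PhiE]; apply: nPhi.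
  by right.
by left; rewrite PhiE; exact: cp_Ad.
Qed.
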